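(* Let $\alpha_0>\alpha_1>\alpha_2>\cdots$ be the zeros of the Digamma function $\psi$. Then $$\sum_{k=0}^\infty\frac{1}{\alpha_k^4}=\gamma^4+\frac{2\gamma^2\pi^2}{3}+\frac{\pi^4}{9}+4\gamma\zeta(3),$$ where $\gamma$ is the Euler constant and $\zeta$ is the Riemann zeta function.
   Context: $\psi(z)=\Gamma'(z)/\Gamma(z)$, $z\in\mathbb C\setminus\{0,-1,-2,\dots\}$, is the Digamma function, with $\Gamma$ the Euler gamma function. It is known that all zeros of $\psi$ are real and simple, and that all of them except one are negative; $\alpha_k$ denotes the $k$th zero counted from the right, so $\alpha_0=1.461632\dots$ is the unique positive zero. *)

(* Defs.v *)
From Stdlib Require Import Reals Factorial.
From Coquelicot Require Import Coquelicot.
Open Scope R_scope.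

Definition Cexp (z : C) : C := (exp (Re z) * cos (Im z), exp (Re z) * sin (Im z)).

(* The principal power [a ^ z], for [a > 0]. *)
Definition Rpow_C (a : R) (z : C) : C := Cexp (z * RtoC (ln a))%C.

(* [z (z + 1) ... (z + n - 1)] *)
Fixpoint Crising (z : C) (n : nat) : C :=
  match n with
  | O => RtoC 1
  | S m => (Crising z m * (z + RtoC (INR m)))%C
  end.

Definition CLim_seq (u : nat -> C) : C :=
  (real (Lim_seq (fun n => Re (u n))), real (Lim_seq (fun n => Im (u n)))).

(* Euler's limit n! n^z / (z (z + 1) ... (z + n)): it converges at every
   complex z other than 0, -1, -2, ..., so that no analytic continuation is
   needed.  The value at those poles is meaningless. *)
Definition Gamma (z : C) : C :=
  CLim_seq (fun n =>
    (RtoC (INR (fact n)) * Rpow_C (INR n) z / Crising z (S n))%C).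

Definition digamma (z : C) : C := (C_derive Gamma z / Gamma z)%C.

Definition digamma_domain (z : C) : Prop :=
  forall n : nat, z <> RtoC (- INR n).

(* The operators above are total, so the domain has to be required. *)
Definition digamma_zero (z : C) : Prop :=
  digamma_domain z /\ digamma z = RtoC 0.

Definition euler_constant : R :=
  real (Lim_seq (fun n => sum_n_m (fun k => / INR k) 1 n - ln (INR n))).

(* Meaningful for [1 < s] only. *)
Definition zeta (s : R) : R := Series (fun n => / Rpower (INR (S n)) s).

(* Main.v *)
Require Import Defs.
From Stdlib Require Import Reals Factorial Ranalysis5 Lra Lia.
From Coquelicot Require Import Coquelicot.
Open Scope R_scope.

(** For [psi_N (x) = ln N - sum_(0 <= j <= N) 1 / (x + j)], which converges to [psi],
    the numerator is a polynomial with [N + 1] real roots, one to the right of [0] and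
    one between any two consecutive poles.  By Newton's identities the sum of
    [1 / r ^ 4] over these roots is a polynomial in the Taylor coefficients of the
    numerator at [0], i.e. in [H_N - ln N] and [sum_(1 <= n <= N) 1 / n ^ s], [s = 2, 3, 4].
    The k-th root tends to the k-th zero of [psi] and has absolute value at least
    [(k + 1) / 12], so Tannery's theorem allows [N] to tend to infinity.
    Everything takes place on the real line, because [C_lim], hence [C_derive],
    only looks at the horizontal line through the point. *)

(** * Convergence of [psi_N] and of Euler's limit *)

(** The obstacle is the passage from zeros to coefficients: for [psi] itself it would take a
    Hadamard product, hence complex analysis. For the numerator of [psiN N] a count of roots
    suffices, because its degree is at most [N + 1] and a sign change is found in [N + 1] disjoint
    brackets, so that no root is missed. The brackets do not depend on [N], and the values at their
    ends stay away from 0 by 1/2. The same intervals therefore serve [psiN N] and [psi]; they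
    separate the roots, supply the majorant for Tannery's theorem and, with a lower bound on the
    slope, make each root converge. That all zeros are real comes with the hypothesis on [alpha], so
    only real zeros have to be matched with it. The limiting power sum contains 2 zeta(2)^2 + 5
    zeta(4); the two values come from cosecant sums by angle doubling. *)

Fixpoint psum (f : nat -> R) (n : nat) : R :=
  match n with O => 0 | S m => psum f m + f m end.

Fixpoint pprod (f : nat -> R) (n : nat) : R :=
  match n with O => 1 | S m => pprod f m * f m end.

Lemma psum_ext f g n : (forall j, (j < n)%nat -> f j = g j) -> psum f n = psum g n.
Proof.
induction n as [|n IH]; simpl; intros H; auto.
rewrite IH, H; auto.
Qed.

Lemma pprod_ext f g n : (forall j, (j < n)%nat -> f j = g j) -> pprod f n = pprod g n.
Proof.
induction n as [|n IH]; simpl; intros H; auto.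
rewrite IH, H; auto.
Qed.

Lemma psum_S f n : psum f (S n) = psum f n + f n.
Proof. reflexivity. Qed.

Lemma psum_plus f g n : psum (fun j => f j + g j) n = psum f n + psum g n.
Proof. induction n as [|n IH]; simpl; [|rewrite IH]; ring. Qed.

Lemma psum_scal c f n : psum (fun j => c * f j) n = c * psum f n.
Proof. induction n as [|n IH]; simpl; [|rewrite IH]; ring. Qed.

Lemma psum_le f g n : (forall j, (j < n)%nat -> f j <= g j) -> psum f n <= psum g n.
Proof.
induction n as [|n IH]; simpl; intros H; [lra|].
apply Rplus_le_compat; auto.
Qed.

Lemma psum_const c n : psum (fun _ => c) n = INR n * c.
Proof. induction n as [|n IH]; [simpl; ring|]. simpl psum. rewrite IH, S_INR; ring. Qed.

Lemma psum_abs f n : Rabs (psum f n) <= psum (fun j => Rabs (f j)) n.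
Proof.
induction n as [|n IH]; simpl; [rewrite Rabs_R0; lra|].
eapply Rle_trans; [apply Rabs_triang|lra].
Qed.

Lemma psum_add f m n : psum f (m + n) = psum f m + psum (fun j => f (m + j)%nat) n.
Proof.
induction n as [|n IH]; simpl.
- rewrite Nat.add_0_r; ring.
- rewrite Nat.add_succ_r; simpl; rewrite IH; ring.
Qed.

Lemma psum_S_l f n : psum f (S n) = f O + psum (fun j => f (S j)) n.
Proof. change (S n) with (1 + n)%nat. rewrite psum_add; simpl; ring. Qed.

Lemma psum_sum_n f n : sum_n f n = psum f (S n).
Proof.
induction n as [|n IH].
- rewrite sum_O; simpl; symmetry; apply Rplus_0_l.
- rewrite sum_Sn, IH; reflexivity.
Qed.

Lemma pprod_neq0 f n : (forall j, (j < n)%nat -> f j <> 0) -> pprod f n <> 0.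
Proof.
induction n as [|n IH]; simpl; intros H; [lra|].
apply Rmult_integral_contrapositive_currified; [apply IH; intros; apply H; lia|apply H; lia].
Qed.

Lemma pprod_mult f g n : pprod (fun j => f j * g j) n = pprod f n * pprod g n.
Proof. induction n as [|n IH]; simpl; [|rewrite IH]; ring. Qed.

Lemma pprod_exp f n : pprod (fun j => exp (f j)) n = exp (psum f n).
Proof. induction n as [|n IH]; simpl; [now rewrite exp_0|now rewrite IH, exp_plus]. Qed.

Lemma is_lim_seq_inv_INR : is_lim_seq (fun n => / INR n) 0.
Proof.
apply (is_lim_seq_inv _ p_infty); [apply is_lim_seq_INR|discriminate].
Qed.

(** The bound telescopes: [u n - K / n] increases, [u n + K / n] decreases and their gap tends to 0,
    so they are adjacent. *)
Lemma ex_lim_seq_quadratic (u : nat -> R) K N :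
  (1 <= N)%nat ->
  (forall n, (N <= n)%nat -> Rabs (u (S n) - u n) <= K * (/ INR n - / INR (S n))) ->
  ex_finite_lim_seq u.
Proof.
intros HN H.
assert (E : ex_finite_lim_seq (fun n => u (n + N)%nat - K * / INR (n + N)) /\
            ex_finite_lim_seq (fun n => u (n + N)%nat + K * / INR (n + N)) /\
            Lim_seq (fun n => u (n + N)%nat - K * / INR (n + N)) =
            Lim_seq (fun n => u (n + N)%nat + K * / INR (n + N))).
{ apply ex_lim_seq_adj.
  - intros n. assert (Hn := H (n + N)%nat ltac:(lia)). apply Rabs_le_between in Hn.
    change (S n + N)%nat with (S (n + N)). lra.
  - intros n. assert (Hn := H (n + N)%nat ltac:(lia)). apply Rabs_le_between in Hn.
    change (S n + N)%nat with (S (n + N)). lra.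
  - apply is_lim_seq_ext with (fun n => 2 * K * / INR (n + N)); [intros; ring|].
    replace (Finite 0) with (Rbar_mult (2 * K) 0) by (simpl; f_equal; ring).
    apply is_lim_seq_scal_l. apply (is_lim_seq_incr_n (fun n => / INR n)).
    apply is_lim_seq_inv_INR. }
destruct E as [[l Hl] _].
exists l. apply is_lim_seq_incr_n with N.
apply is_lim_seq_ext with (fun n => (u (n + N)%nat - K * / INR (n + N)) + K * / INR (n + N)).
{ intros; ring. }
replace (Finite l) with (Finite (l + K * 0)) by (f_equal; ring).
apply is_lim_seq_plus'; auto.
apply (is_lim_seq_scal_l _ K 0).
apply (is_lim_seq_incr_n (fun n => / INR n)), is_lim_seq_inv_INR.
Qed.

(** Both sides are 1 + y <= exp y, at y = - ln (1 + u) and at y = ln (1 + u). *)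
Lemma ln_1p_bounds u : -1 < u -> u / (1 + u) <= ln (1 + u) <= u.
Proof.
intros Hu; split.
- replace (u / (1 + u)) with (- (/ (1 + u) - 1)) by (field; lra).
  replace (ln (1 + u)) with (- ln (/ (1 + u))) by (rewrite ln_Rinv; lra).
  apply Ropp_le_contravar.
  assert (H := exp_ineq1_le (ln (/ (1 + u)))).
  rewrite exp_ln in H by (apply Rinv_0_lt_compat; lra). lra.
- assert (H := exp_ineq1_le (ln (1 + u))). rewrite exp_ln in H; lra.
Qed.

Lemma ln_1p_quadratic u : Rabs u <= / 2 -> 0 <= u - ln (1 + u) <= 2 * u ^ 2.
Proof.
intros Hu. apply Rabs_le_between in Hu.
assert (H := ln_1p_bounds u ltac:(lra)).
split; [lra|].
assert (u - u / (1 + u) <= 2 * u ^ 2); [|lra].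
replace (u - u / (1 + u)) with (u ^ 2 * / (1 + u)) by (field; lra).
assert (/ (1 + u) <= / (/ 2)) by (apply Rinv_le_contravar; lra).
rewrite Rinv_inv in H0. assert (0 <= u ^ 2) by apply pow2_ge_0. nra.
Qed.

Lemma ln_succ_bounds n : (1 <= n)%nat ->
  / INR (S n) <= ln (INR (S n)) - ln (INR n) <= / INR n.
Proof.
intros Hn. assert (0 < INR n) by (apply lt_0_INR; lia).
rewrite <- ln_div by (rewrite ?S_INR; lra).
replace (INR (S n) / INR n) with (1 + / INR n) by (rewrite S_INR; field; lra).
assert (0 < / INR n) by (apply Rinv_0_lt_compat; lra).
assert (B := ln_1p_bounds (/ INR n) ltac:(lra)).
replace (/ INR (S n)) with (/ INR n / (1 + / INR n)) by (rewrite S_INR; field; lra).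
exact B.
Qed.

Definition nonpole (x : R) := forall j : nat, x + INR j <> 0.

Definition gammaN (n : nat) (x : R) : R :=
  INR (fact n) * exp (x * ln (INR n)) / pprod (fun j => x + INR j) (S n).

(** The logarithmic derivative of [gammaN n]. *)
Definition psiN (n : nat) (x : R) : R :=
  ln (INR n) - psum (fun j => / (x + INR j)) (S n).

Definition psi (x : R) : R := real (Lim_seq (fun n => psiN n x)).

Definition gammaR (x : R) : R := real (Lim_seq (fun n => gammaN n x)).

Lemma inv_diff_succ n : (1 <= n)%nat -> / INR n - / INR (S n) = / (INR n * INR (S n)).
Proof.
intros Hn. assert (0 < INR n) by (apply lt_0_INR; lia). rewrite S_INR. field; lra.
Qed.

Lemma large_index x : exists N, (1 <= N)%nat /\
  forall n, (N <= n)%nat -> 2 * Rabs x + 1 <= INR n.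
Proof.
destruct (INR_unbounded (2 * Rabs x + 1)) as [N HN].
exists (S N); split; [lia|]. intros n Hn.
apply Rle_trans with (INR N); [lra|apply le_INR; lia].
Qed.

(** Comparing the increment with 1/(n + 1) splits it into two errors, at most 1/n - 1/(n + 1) and 2
    |x| / (n (n + 1)). At a pole one summand takes the default value of [/ 0], which does not affect
    the tail. *)
Lemma psiN_lim x : is_lim_seq (fun n => psiN n x) (psi x).
Proof.
apply Lim_seq_correct'.
destruct (large_index x) as [N [HN1 HN]].
apply ex_lim_seq_quadratic with (1 + 2 * Rabs x) N; auto.
intros n Hn. unfold psiN. rewrite (psum_S _ (S n)).
assert (Hx := HN n Hn).
assert (B := ln_succ_bounds n ltac:(lia)).
rewrite inv_diff_succ by lia.
assert (Hn0 : 0 < INR n) by (apply lt_0_INR; lia).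
assert (I := inv_diff_succ n ltac:(lia)).
set (y := INR (S n)) in *. assert (Hy : y = INR n + 1) by apply S_INR.
assert (Hxa := Rle_abs x). assert (Hxb := Rle_abs (- x)). rewrite Rabs_Ropp in Hxb.
assert (Hd : INR n / 2 < x + y) by lra.
assert (D : Rabs (/ y - / (x + y)) <= 2 * Rabs x * / (INR n * y)).
{ replace (/ y - / (x + y)) with (x * / ((x + y) * y)) by (field; lra).
  rewrite Rabs_mult, (Rabs_pos_eq (/ _)) by (left; apply Rinv_0_lt_compat; nra).
  rewrite Rmult_comm, (Rmult_comm 2), Rmult_assoc, (Rmult_comm (Rabs x)).
  apply Rmult_le_compat_r; [apply Rabs_pos|].
  replace (2 * / (INR n * y)) with (/ (INR n / 2 * y)) by (field; lra).
  apply Rinv_le_contravar; nra. }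
apply Rabs_le_between in D. apply Rabs_le_between. lra.
Qed.

Lemma gammaN_succ x n : nonpole x -> (1 <= n)%nat -> 0 < 1 + x / INR (S n) ->
  gammaN (S n) x = gammaN n x *
    exp (x * (ln (INR (S n)) - ln (INR n)) - ln (1 + x / INR (S n))).
Proof.
intros Hx Hn Hp. unfold gammaN.
assert (Hprod : pprod (fun j => x + INR j) (S n) <> 0) by (apply pprod_neq0; auto).
change (pprod (fun j => x + INR j) (S (S n))) with
  (pprod (fun j => x + INR j) (S n) * (x + INR (S n))).
rewrite fact_simpl, mult_INR.
assert (HS : 0 < INR (S n)) by (apply lt_0_INR; lia).
assert (HxS := Hx (S n)).
unfold Rminus. rewrite exp_plus, exp_Ropp, exp_ln by auto.
replace (x * (ln (INR (S n)) + - ln (INR n))) with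
  (x * ln (INR (S n)) + - (x * ln (INR n))) by ring.
rewrite exp_plus, exp_Ropp.
assert (E1 := exp_pos (x * ln (INR n))).
field; repeat split; try lra.
Qed.

(** Logarithms are taken only of the ratios of consecutive terms beyond [N], which are positive
    whatever the sign of [gammaN N x]. The limit is then [gammaN N x] times an exponential, hence
    nonzero. *)
Lemma gammaN_lim x : nonpole x ->
  is_lim_seq (fun n => gammaN n x) (gammaR x) /\ gammaR x <> 0.
Proof.
intros Hx.
destruct (large_index x) as [N [HN1 HN]].
pose (delta n := x * (ln (INR (S n)) - ln (INR n)) - ln (1 + x / INR (S n))).
assert (Hu : forall n, (N <= n)%nat -> Rabs (x / INR (S n)) <= / 2).
{ intros n Hn. assert (H := HN n Hn). rewrite S_INR.
  assert (Hp := Rabs_pos x).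
  unfold Rdiv. rewrite Rabs_mult, (Rabs_pos_eq (/ _)) by (left; apply Rinv_0_lt_compat; lra).
  apply Rmult_le_reg_r with (INR n + 1); [lra|].
  rewrite Rmult_assoc, Rinv_l by lra. lra. }
assert (Hd : forall n, (N <= n)%nat ->
  Rabs (delta n) <= (Rabs x + 2 * x ^ 2) * (/ INR n - / INR (S n))).
{ intros n Hn. unfold delta.
  assert (Hn0 : 0 < INR n) by (apply lt_0_INR; lia).
  assert (L := ln_succ_bounds n ltac:(lia)).
  assert (Q := ln_1p_quadratic _ (Hu n Hn)).
  replace (x * (ln (INR (S n)) - ln (INR n)) - ln (1 + x / INR (S n))) with
   (x * (ln (INR (S n)) - ln (INR n) - / INR (S n)) + (x / INR (S n) - ln (1 + x / INR (S n))))
    by (field; rewrite S_INR; lra).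
  eapply Rle_trans; [apply Rabs_triang|]. rewrite Rmult_plus_distr_r.
  apply Rplus_le_compat.
  - rewrite Rabs_mult. apply Rmult_le_compat_l; [apply Rabs_pos|].
    rewrite Rabs_pos_eq; lra.
  - rewrite Rabs_pos_eq by lra. eapply Rle_trans; [apply Q|].
    rewrite Rmult_assoc. apply Rmult_le_compat_l; [lra|].
    rewrite inv_diff_succ by lia. unfold Rdiv. rewrite Rpow_mult_distr.
    apply Rmult_le_compat_l; [apply pow2_ge_0|].
    rewrite pow_inv. apply Rinv_le_contravar; rewrite S_INR; nra. }
assert (HC : ex_finite_lim_seq (fun n => psum (fun k => delta (N + k)%nat) (n - N))).
{ apply ex_lim_seq_quadratic with (Rabs x + 2 * x ^ 2) N; auto.
  intros n Hn. replace (S n - N)%nat with (S (n - N)) by lia. simpl psum.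
  replace (N + (n - N))%nat with n by lia.
  replace (_ + delta n - _) with (delta n) by ring. auto. }
destruct HC as [l Hl].
assert (Hg : forall k, gammaN (k + N) x = gammaN N x * exp (psum (fun k => delta (N + k)%nat) k)).
{ induction k as [|k IH]; simpl psum.
  - simpl. rewrite exp_0; ring.
  - change (S k + N)%nat with (S (k + N)). rewrite gammaN_succ; auto; [|lia|].
    + rewrite IH, exp_plus. unfold delta. rewrite (Nat.add_comm N k). ring.
    + assert (H := Hu (k + N)%nat ltac:(lia)). apply Rabs_le_between in H. lra. }
assert (Hlim : is_lim_seq (fun n => gammaN n x) (gammaN N x * exp l)).
{ apply is_lim_seq_incr_n with N.
  apply is_lim_seq_ext with (1 := fun k => eq_sym (Hg k)).
  apply (is_lim_seq_scal_l _ _ (Finite (exp l))).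
  apply is_lim_seq_continuous; [apply derivable_continuous_pt, derivable_pt_exp|].
  apply (is_lim_seq_incr_n _ N) in Hl.
  apply is_lim_seq_ext with (2 := Hl).
  intros n. now rewrite Nat.add_sub. }
assert (E : gammaR x = gammaN N x * exp l).
{ unfold gammaR. rewrite (is_lim_seq_unique _ _ Hlim). reflexivity. }
rewrite E. split; auto.
apply Rmult_integral_contrapositive; split; [|apply Rgt_not_eq, exp_pos].
unfold gammaN. apply Rmult_integral_contrapositive; split.
- apply Rmult_integral_contrapositive; split; [apply INR_fact_neq_0|apply Rgt_not_eq, exp_pos].
- apply Rinv_neq_0_compat, pprod_neq0; auto.
Qed.

(** * The digamma function on the real line *)

(** A gap growing linearly in [j] reduces every sum over the poles to the sum of 1/(j + 1)^2 and
    survives a shift of [x] by c/2. Finitely many [j] are handled by a minimum; from j >= 2 |x| + 1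
    on, |x + j| >= (j + 1)/2, whence the cap of 1/2 on [c]. *)
Lemma pole_gap x : nonpole x ->
  exists c, 0 < c /\ forall j, c * (INR j + 1) <= Rabs (x + INR j).
Proof.
intros Hx.
destruct (large_index x) as [N [_ HN]].
assert (F : forall n, exists c, 0 < c <= / 2 /\
  forall j, (j < n)%nat -> c * (INR j + 1) <= Rabs (x + INR j)).
{ induction n as [|n [c [Hc IH]]].
  - exists (/ 2); split; [lra|]. intros; lia.
  - assert (Hp := Rabs_pos_lt _ (Hx n)). assert (Hn := pos_INR n).
    assert (Hd : 0 < Rabs (x + INR n) / (INR n + 1)) by (apply Rdiv_lt_0_compat; lra).
    exists (Rmin c (Rabs (x + INR n) / (INR n + 1))). repeat split.
    + apply Rmin_glb_lt; lra.
    + eapply Rle_trans; [apply Rmin_l|lra].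
    + intros j Hj. assert (Hj0 := pos_INR j). destruct (Nat.eq_dec j n) as [->|Hjn].
      * apply Rle_trans with (Rabs (x + INR n) / (INR n + 1) * (INR n + 1)).
        -- apply Rmult_le_compat_r; [lra|apply Rmin_r].
        -- right; field; lra.
      * apply Rle_trans with (c * (INR j + 1)).
        -- apply Rmult_le_compat_r; [lra|apply Rmin_l].
        -- apply IH; lia. }
destruct (F N) as [c [Hc HF]].
exists c; split; [lra|]. intros j.
destruct (Nat.lt_ge_cases j N) as [Hj|Hj]; [auto|].
assert (H := HN j Hj). assert (Hj0 := pos_INR j).
apply Rle_trans with (/ 2 * (INR j + 1)); [nra|].
assert (A := Rabs_triang_inv (INR j) (- x)).
rewrite Rabs_Ropp, (Rabs_pos_eq (INR j)) in A by lra.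
replace (INR j - - x) with (x + INR j) in A by ring. lra.
Qed.

Lemma pole_gap_near c x y : 0 < c -> (forall j, c * (INR j + 1) <= Rabs (x + INR j)) ->
  Rabs (y - x) <= c / 2 -> forall j, c / 2 * (INR j + 1) <= Rabs (y + INR j).
Proof.
intros Hc Hx Hy j. assert (H := Hx j). assert (Hj := pos_INR j).
assert (A := Rabs_triang_inv (x + INR j) (x - y)).
replace (x + INR j - (x - y)) with (y + INR j) in A by ring.
rewrite (Rabs_minus_sym x y) in A. nra.
Qed.

Lemma pole_gap_nonpole c x : 0 < c -> (forall j, c * (INR j + 1) <= Rabs (x + INR j)) ->
  nonpole x.
Proof.
intros Hc H j E. specialize (H j). rewrite E, Rabs_R0 in H.
assert (Hj := pos_INR j). nra.
Qed.

Lemma psum_inv_sq n : psum (fun j => / (INR j + 1) ^ 2) n <= 2.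
Proof.
destruct n as [|n]; [simpl; lra|].
(* The bare bound 2 is not inductive; with 1/(n + 1) subtracted the sum telescopes. *)
assert (H : psum (fun j => / (INR j + 1) ^ 2) (S n) <= 2 - / (INR n + 1)).
{ induction n as [|n IH]; [simpl; right; field|].
  rewrite psum_S, S_INR. rewrite ?S_INR in *. assert (Hn := pos_INR n).
  assert (/ (INR n + 1 + 1) ^ 2 <= / (INR n + 1) - / (INR n + 1 + 1)); [|lra].
  replace (/ (INR n + 1) - / (INR n + 1 + 1)) with (/ ((INR n + 1) * (INR n + 1 + 1)))
    by (field; lra).
  apply Rinv_le_contravar; nra. }
assert (0 < / (INR n + 1)); [|lra].
apply Rinv_0_lt_compat. assert (Hn := pos_INR n); lra.
Qed.

(** The constant does not depend on [n], so the estimate passes to [psi]. It is (1/c)(2/c) from the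
    two gaps, times 2 from [psum_inv_sq]. *)
Lemma psiN_lipschitz c x y n : 0 < c ->
  (forall j, c * (INR j + 1) <= Rabs (x + INR j)) ->
  Rabs (y - x) <= c / 2 ->
  Rabs (psiN n y - psiN n x) <= 4 / c ^ 2 * Rabs (y - x).
Proof.
intros Hc Hx Hy.
assert (Hy' := pole_gap_near _ _ _ Hc Hx Hy).
assert (Nx := pole_gap_nonpole _ _ Hc Hx).
assert (Ny := pole_gap_nonpole (c / 2) y ltac:(lra) Hy').
replace (psiN n y - psiN n x) with
  (psum (fun j => / (x + INR j) + (-1) * / (y + INR j)) (S n))
  by (rewrite psum_plus, psum_scal; unfold psiN; ring).
eapply Rle_trans; [apply psum_abs|].
apply Rle_trans with (psum (fun j => (2 / c ^ 2 * Rabs (y - x)) * / (INR j + 1) ^ 2) (S n)).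
- apply psum_le. intros j _.
  assert (Hxj := Hx j). assert (Hyj := Hy' j). assert (Hj := pos_INR j).
  replace (/ (x + INR j) + -1 * / (y + INR j)) with
    ((y - x) * / ((x + INR j) * (y + INR j))) by (field; split; auto).
  rewrite Rabs_mult, Rabs_inv, Rabs_mult.
  replace (2 / c ^ 2 * Rabs (y - x) * / (INR j + 1) ^ 2) with
    (Rabs (y - x) * / (c * (INR j + 1) * (c / 2 * (INR j + 1)))) by (field; lra).
  apply Rmult_le_compat_l; [apply Rabs_pos|].
  apply Rinv_le_contravar; [apply Rmult_lt_0_compat; apply Rmult_lt_0_compat; lra|].
  apply Rmult_le_compat; auto; apply Rmult_le_pos; lra.
- rewrite psum_scal.
  replace (4 / c ^ 2 * Rabs (y - x)) with (2 / c ^ 2 * Rabs (y - x) * 2) by (field; lra).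
  apply Rmult_le_compat_l; [|apply psum_inv_sq].
  apply Rmult_le_pos; [|apply Rabs_pos]. apply Rlt_le, Rdiv_lt_0_compat; nra.
Qed.

Lemma psi_lipschitz c x y : 0 < c ->
  (forall j, c * (INR j + 1) <= Rabs (x + INR j)) ->
  Rabs (y - x) <= c / 2 ->
  Rabs (psi y - psi x) <= 4 / c ^ 2 * Rabs (y - x).
Proof.
intros Hc Hx Hy.
apply (is_lim_seq_le (fun n => Rabs (psiN n y - psiN n x))
  (fun _ => 4 / c ^ 2 * Rabs (y - x)) (Rabs (psi y - psi x)) (4 / c ^ 2 * Rabs (y - x))).
- intros n. now apply psiN_lipschitz.
- apply (is_lim_seq_abs _ (Finite _)). apply is_lim_seq_minus'; apply psiN_lim.
- apply is_lim_seq_const.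
Qed.

Lemma local_lipschitz_continuity_pt f x K d : 0 < d -> 0 <= K ->
  (forall y, Rabs (y - x) <= d -> Rabs (f y - f x) <= K * Rabs (y - x)) ->
  continuity_pt f x.
Proof.
intros Hd HK H eps Heps.
assert (HK' : 0 < eps / (K + 1)) by (apply Rdiv_lt_0_compat; lra).
exists (Rmin d (eps / (K + 1))). split; [apply Rmin_glb_lt; lra|].
intros y [_ Hy]. unfold dist in *; simpl in *; unfold R_dist in *.
assert (H1 := Rmin_l d (eps / (K + 1))). assert (H2 := Rmin_r d (eps / (K + 1))).
eapply Rle_lt_trans; [apply H; lra|].
apply Rle_lt_trans with ((K + 1) * Rabs (y - x)).
{ assert (P := Rabs_pos (y - x)); nra. }
apply Rlt_le_trans with ((K + 1) * (eps / (K + 1))); [|right; field; lra].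
apply Rmult_lt_compat_l; lra.
Qed.

Lemma psiN_continuity n x : nonpole x -> continuity_pt (psiN n) x.
Proof.
intros Hx. destruct (pole_gap x Hx) as [c [Hc H]].
apply local_lipschitz_continuity_pt with (4 / c ^ 2) (c / 2); [lra| |].
- apply Rlt_le, Rdiv_lt_0_compat; nra.
- intros y Hy. now apply psiN_lipschitz.
Qed.

Lemma psi_continuity x : nonpole x -> continuity_pt psi x.
Proof.
intros Hx. destruct (pole_gap x Hx) as [c [Hc H]].
apply local_lipschitz_continuity_pt with (4 / c ^ 2) (c / 2); [lra| |].
- apply Rlt_le, Rdiv_lt_0_compat; nra.
- intros y Hy. now apply psi_lipschitz.
Qed.

(** An exact first-order expansion in the exponent: what remains is a sum of nonnegative terms of
    size O(h^2). It lets the derivative of the limit be read off without interchanging limit and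
    derivative. *)
Lemma gammaN_shift n x h :
  nonpole x -> (forall j, 0 < 1 + h / (x + INR j)) ->
  gammaN n (x + h) = gammaN n x *
    exp (h * psiN n x + psum (fun j => h / (x + INR j) - ln (1 + h / (x + INR j))) (S n)).
Proof.
intros Hx Hh. unfold gammaN, psiN.
assert (E : pprod (fun j => x + h + INR j) (S n) =
  pprod (fun j => x + INR j) (S n) * exp (psum (fun j => ln (1 + h / (x + INR j))) (S n))).
{ rewrite <- pprod_exp, <- pprod_mult. apply pprod_ext. intros j _.
  rewrite exp_ln by auto. field. apply Hx. }
rewrite E.
assert (Hprod : pprod (fun j => x + INR j) (S n) <> 0) by (apply pprod_neq0; auto).
replace (h * (ln (INR n) - psum (fun j => / (x + INR j)) (S n)) +
  psum (fun j => h / (x + INR j) - ln (1 + h / (x + INR j))) (S n)) with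
  (h * ln (INR n) + - psum (fun j => ln (1 + h / (x + INR j))) (S n)).
2:{ rewrite (psum_ext (fun j => h / (x + INR j) - ln (1 + h / (x + INR j)))
     (fun j => h * / (x + INR j) + (-1) * ln (1 + h / (x + INR j)))).
    - rewrite psum_plus, !psum_scal. ring.
    - intros; unfold Rdiv; ring. }
rewrite exp_plus, exp_Ropp, Rmult_plus_distr_r, exp_plus.
assert (P := exp_pos (psum (fun j => ln (1 + h / (x + INR j))) (S n))).
field. split; lra.
Qed.

(** [rho] is the limit of the remainders in [gammaN_shift], which increase with [n]. The condition
    |h| <= c/2 makes each h/(x + j) at most 1/2, as [ln_1p_quadratic] requires; 4 is its factor 2
    times the bound of [psum_inv_sq]. *)
Lemma gammaR_shift c x h : 0 < c ->
  (forall j, c * (INR j + 1) <= Rabs (x + INR j)) -> Rabs h <= c / 2 ->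
  exists rho, 0 <= rho <= 4 / c ^ 2 * h ^ 2 /\
    gammaR (x + h) = gammaR x * exp (h * psi x + rho).
Proof.
intros Hc Hx Hh.
assert (Nx := pole_gap_nonpole _ _ Hc Hx).
assert (Nxh : nonpole (x + h)).
{ apply pole_gap_nonpole with (c / 2); [lra|]. apply pole_gap_near with x; auto.
  now replace (x + h - x) with h by ring. }
assert (Hu : forall j, Rabs (h / (x + INR j)) <= Rabs h * / (c * (INR j + 1))).
{ intros j. assert (Hj := pos_INR j). unfold Rdiv. rewrite Rabs_mult, Rabs_inv.
  apply Rmult_le_compat_l; [apply Rabs_pos|].
  apply Rinv_le_contravar; [apply Rmult_lt_0_compat; lra|auto]. }
assert (Hu2 : forall j, Rabs (h / (x + INR j)) <= / 2).
{ intros j. assert (Hj := pos_INR j). eapply Rle_trans; [apply Hu|].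
  apply Rmult_le_reg_r with (c * (INR j + 1)); [nra|].
  rewrite Rmult_assoc, Rinv_l by nra. nra. }
pose (r n := psum (fun j => h / (x + INR j) - ln (1 + h / (x + INR j))) (S n)).
assert (Hr0 : forall j, 0 <= h / (x + INR j) - ln (1 + h / (x + INR j))
    <= 2 * h ^ 2 / c ^ 2 * / (INR j + 1) ^ 2).
{ intros j. assert (Q := ln_1p_quadratic _ (Hu2 j)). split; [apply Q|].
  eapply Rle_trans; [apply Q|]. assert (Hj := pos_INR j).
  replace (2 * h ^ 2 / c ^ 2 * / (INR j + 1) ^ 2) with
    (2 * (Rabs h * / (c * (INR j + 1))) ^ 2).
  - rewrite <- (pow2_abs (h / _)). apply Rmult_le_compat_l; [lra|].
    apply pow_incr; split; [apply Rabs_pos|auto].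
  - rewrite Rpow_mult_distr, pow2_abs. field; lra. }
assert (Hrb : forall n, 0 <= r n <= 4 / c ^ 2 * h ^ 2).
{ intros n. split.
  - unfold r. rewrite <- (Rmult_0_r (INR (S n))), <- psum_const. apply psum_le.
    intros j _; apply Hr0.
  - apply Rle_trans with (psum (fun j => 2 * h ^ 2 / c ^ 2 * / (INR j + 1) ^ 2) (S n)).
    + apply psum_le. intros j _; apply Hr0.
    + rewrite psum_scal.
      replace (4 / c ^ 2 * h ^ 2) with (2 * h ^ 2 / c ^ 2 * 2) by (field; lra).
      apply Rmult_le_compat_l; [|apply psum_inv_sq].
      assert (P := pow2_ge_0 h). apply Rmult_le_pos; [lra|].
      left; apply Rinv_0_lt_compat; nra. }
destruct (ex_finite_lim_seq_incr r (4 / c ^ 2 * h ^ 2)) as [rho Hrho].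
{ intros n. unfold r. rewrite (psum_S _ (S n)). assert (Q := Hr0 (S n)). lra. }
{ intros n; apply Hrb. }
exists rho. split.
- split.
  + apply (is_lim_seq_le (fun _ => 0) r 0 rho); auto; [intros; apply Hrb|apply is_lim_seq_const].
  + apply (is_lim_seq_le r (fun _ => 4 / c ^ 2 * h ^ 2) rho (4 / c ^ 2 * h ^ 2)); auto;
      [intros; apply Hrb|apply is_lim_seq_const].
- destruct (gammaN_lim _ Nx) as [L1 _]. destruct (gammaN_lim _ Nxh) as [L2 _].
  assert (L3 : is_lim_seq (fun n => gammaN n (x + h)) (gammaR x * exp (h * psi x + rho))).
  { apply is_lim_seq_ext with (fun n => gammaN n x * exp (h * psiN n x + r n)).
    - intros n. symmetry. apply gammaN_shift; auto.
      intros j. assert (Q := Hu2 j). apply Rabs_le_between in Q. lra.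
    - apply is_lim_seq_mult'; auto.
      apply is_lim_seq_continuous; [apply derivable_continuous_pt, derivable_pt_exp|].
      apply is_lim_seq_plus'; auto.
      apply (is_lim_seq_scal_l _ h (psi x)), psiN_lim. }
  apply is_lim_seq_unique in L2. apply is_lim_seq_unique in L3. congruence.
Qed.

Lemma exp_quadratic v : Rabs v <= / 2 -> 0 <= exp v - 1 - v <= 2 * v ^ 2.
Proof.
intros Hv. apply Rabs_le_between in Hv.
assert (H := exp_ineq1_le v). assert (H' := exp_ineq1_le (- v)).
rewrite exp_Ropp in H'. split; [lra|].
assert (P := exp_pos v).
assert (E : exp v <= / (1 - v)).
{ rewrite <- (Rinv_inv (exp v)). apply Rinv_le_contravar; lra. }
assert (/ (1 - v) - 1 - v <= 2 * v ^ 2); [|lra].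
replace (/ (1 - v) - 1 - v) with (v ^ 2 * / (1 - v)) by (field; lra).
rewrite Rmult_comm. apply Rmult_le_compat_r; [apply pow2_ge_0|].
replace 2 with (/ / 2) by field. apply Rinv_le_contravar; lra.
Qed.

Lemma gammaR_quotient_lim x : nonpole x ->
  is_lim (fun t => (gammaR t - gammaR x) / (t - x)) x (gammaR x * psi x).
Proof.
intros Hx. destruct (pole_gap x Hx) as [c [Hc Hg]].
(* For |h| <= 1 the exponent [v] below satisfies |v| <= A |h|, so |h| <= 1/(2A) brings it into the
   range of [exp_quadratic]. [K] collects the quadratic errors of [rho] and of exp. *)
pose (A := Rabs (psi x) + 4 / c ^ 2).
assert (HC : 0 < 4 / c ^ 2) by (apply Rdiv_lt_0_compat; nra).
assert (HA : 0 < A) by (unfold A; assert (P := Rabs_pos (psi x)); lra).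
pose (K := Rabs (gammaR x) * (4 / c ^ 2 + 2 * A ^ 2)).
assert (HK : 0 <= K).
{ unfold K. apply Rmult_le_pos; [apply Rabs_pos|]. nra. }
assert (B : forall h, Rabs h <= c / 2 -> Rabs h <= 1 -> Rabs h <= / (2 * A) -> h <> 0 ->
  Rabs ((gammaR (x + h) - gammaR x) / h - gammaR x * psi x) <= K * Rabs h).
{ intros h H1 H2 H3 H0.
  destruct (gammaR_shift c x h Hc Hg H1) as [rho [Hrho E]]. rewrite E.
  assert (Hp := Rabs_pos_lt _ H0).
  set (v := h * psi x + rho).
  assert (Hv : Rabs v <= Rabs h * A).
  { unfold v, A. eapply Rle_trans; [apply Rabs_triang|].
    rewrite Rabs_mult, Rmult_plus_distr_l. apply Rplus_le_compat_l.
    rewrite (Rabs_pos_eq rho) by lra. eapply Rle_trans; [apply Hrho|].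
    rewrite <- (pow2_abs h), (Rmult_comm (4 / c ^ 2)). apply Rmult_le_compat_r; [lra|].
    rewrite <- (Rmult_1_r (Rabs h)) at 2. simpl.
    apply Rmult_le_compat_l; lra. }
  assert (Hv2 : Rabs v <= / 2).
  { eapply Rle_trans; [apply Hv|].
    replace (/ 2) with (/ (2 * A) * A) by (field; lra).
    apply Rmult_le_compat_r; lra. }
  assert (Q := exp_quadratic v Hv2).
  replace ((gammaR x * exp v - gammaR x) / h - gammaR x * psi x) with
    (gammaR x * ((rho + (exp v - 1 - v)) / h)) by (unfold v; field; auto).
  unfold K. rewrite Rabs_mult, Rmult_assoc. apply Rmult_le_compat_l; [apply Rabs_pos|].
  unfold Rdiv. rewrite Rabs_mult, Rabs_inv.
  apply Rmult_le_reg_r with (Rabs h); auto.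
  rewrite Rmult_assoc, Rinv_l, Rmult_1_r by lra.
  rewrite Rabs_pos_eq by lra.
  rewrite Rmult_assoc, Rmult_plus_distr_r. apply Rplus_le_compat.
  - replace (Rabs h * Rabs h) with (h ^ 2) by (rewrite <- pow2_abs; ring). apply Hrho.
  - eapply Rle_trans; [apply Q|]. rewrite <- (pow2_abs v).
    assert (Rabs v ^ 2 <= (Rabs h * A) ^ 2) by (apply pow_incr; split; [apply Rabs_pos|auto]).
    nra. }
apply is_lim_spec. intros eps.
assert (He := cond_pos eps).
assert (D : 0 < Rmin (Rmin (c / 2) 1) (Rmin (/ (2 * A)) (eps / (K + 1)))).
{ repeat apply Rmin_glb_lt; try lra.
  - apply Rinv_0_lt_compat; lra.
  - apply Rdiv_lt_0_compat; lra. }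
exists (mkposreal _ D). intros t Ht Htx.
change (Rabs (t - x) < Rmin (Rmin (c / 2) 1) (Rmin (/ (2 * A)) (eps / (K + 1)))) in Ht.
apply Rmin_Rgt in Ht; destruct Ht as [Ht1 Ht2].
apply Rmin_Rgt in Ht1; destruct Ht1 as [Ha Hb].
apply Rmin_Rgt in Ht2; destruct Ht2 as [Hcc Hd].
specialize (B (t - x) ltac:(lra) ltac:(lra) ltac:(lra) ltac:(lra)).
rewrite Rplus_minus in B.
eapply Rle_lt_trans; [apply B|].
apply Rle_lt_trans with ((K + 1) * Rabs (t - x)).
{ assert (P := Rabs_pos (t - x)); nra. }
replace (pos eps) with ((K + 1) * (eps / (K + 1))) by (field; lra).
apply Rmult_lt_compat_l; lra.
Qed.

Lemma Crising_RtoC x n : Crising (RtoC x) n = RtoC (pprod (fun j => x + INR j) n).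
Proof.
induction n as [|n IH]; simpl; [reflexivity|].
now rewrite IH, <- RtoC_plus, <- RtoC_mult.
Qed.

Lemma Cexp_RtoC x : Cexp (RtoC x) = RtoC (exp x).
Proof.
unfold Cexp, RtoC; simpl. rewrite cos_0, sin_0. f_equal; ring.
Qed.

Lemma Gamma_RtoC x : nonpole x -> Gamma (RtoC x) = RtoC (gammaR x).
Proof.
intros Hx. unfold Gamma, CLim_seq.
assert (E : forall n, (RtoC (INR (fact n)) * Rpow_C (INR n) (RtoC x) / Crising (RtoC x) (S n))%C
  = RtoC (gammaN n x)).
{ intros n. unfold Rpow_C, gammaN.
  rewrite <- RtoC_mult, Cexp_RtoC, <- RtoC_mult, Crising_RtoC, <- RtoC_div; auto.
  apply pprod_neq0; auto. }
change (RtoC (gammaR x)) with (gammaR x, 0). f_equal.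
- unfold gammaR. f_equal. apply Lim_seq_ext. intros n. now rewrite E.
- rewrite (Lim_seq_ext _ (fun _ => 0)); [now rewrite Lim_seq_const|].
  intros n. now rewrite E.
Qed.

Lemma digamma_RtoC x : nonpole x -> digamma (RtoC x) = RtoC (psi x).
Proof.
intros Hx. destruct (gammaN_lim x Hx) as [_ Hne].
unfold digamma.
assert (D : C_derive Gamma (RtoC x) = RtoC (gammaR x * psi x)).
{ unfold C_derive, C_lim.
  change (fst (RtoC x)) with x. change (snd (RtoC x)) with 0.
  destruct (pole_gap x Hx) as [c [Hc Hg]].
  (* Within c/2 of [x] there is no pole, so the complex difference quotient is the real one and its
     imaginary part vanishes. *)
  assert (E : Rbar_locally' x (fun t =>
    ((Gamma (t, 0) - Gamma (RtoC x)) / ((t, 0) - RtoC x))%C =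
      RtoC ((gammaR t - gammaR x) / (t - x)))).
  { assert (Hc2 : 0 < c / 2) by lra.
    exists (mkposreal _ Hc2). intros t Ht Htx.
    change (Rabs (t - x) < c / 2) in Ht.
    change (t, 0) with (RtoC t). rewrite !Gamma_RtoC; auto.
    - rewrite <- !RtoC_minus, <- RtoC_div; auto; lra.
    - apply pole_gap_nonpole with (c / 2); auto.
      apply pole_gap_near with x; auto; lra. }
  change (RtoC (gammaR x * psi x)) with (gammaR x * psi x, 0). f_equal.
  - apply (f_equal real (y := Finite _)). apply is_lim_unique.
    apply is_lim_ext_loc with (2 := gammaR_quotient_lim x Hx).
    apply filter_imp with (2 := E). intros t Ht. now rewrite Ht.
  - apply (f_equal real (y := Finite 0)). apply is_lim_unique.
    apply is_lim_ext_loc with (fun _ => 0); [|apply is_lim_const].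
    apply filter_imp with (2 := E). intros t Ht. now rewrite Ht. }
rewrite D, Gamma_RtoC by auto. rewrite <- RtoC_div by auto.
f_equal. field; auto.
Qed.

Lemma digamma_zero_RtoC x : digamma_zero (RtoC x) <-> nonpole x /\ psi x = 0.
Proof.
assert (N : digamma_domain (RtoC x) <-> nonpole x).
{ unfold digamma_domain, nonpole. split; intros H j E; apply (H j).
  - f_equal; lra.
  - apply RtoC_inj in E. lra. }
unfold digamma_zero. rewrite N. split; intros [H1 H2]; split; auto.
- rewrite digamma_RtoC in H2; auto. now apply RtoC_inj.
- now rewrite digamma_RtoC, H2.
Qed.

(** * Tannery's theorem and the values of zeta *)

Lemma is_series_psum a l : is_series a l <-> is_lim_seq (psum a) l.
Proof.
split; intros H.
- apply is_lim_seq_incr_1. apply is_lim_seq_ext with (2 := H). intros n; apply psum_sum_n.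
- apply is_lim_seq_incr_1 in H. apply is_lim_seq_ext with (2 := H).
  intros n; symmetry; apply psum_sum_n.
Qed.

Lemma psum_mono f m n : (forall k, 0 <= f k) -> (m <= n)%nat -> psum f m <= psum f n.
Proof.
intros Hf H. induction H as [|n H IH]; [lra|]. rewrite psum_S. specialize (Hf n). lra.
Qed.

Lemma ex_series_psum_bounded a B : (forall k, 0 <= a k) -> (forall n, psum a n <= B) ->
  ex_series a.
Proof.
intros Ha HB. destruct (ex_finite_lim_seq_incr (psum a) B) as [l Hl]; auto.
- intros n. rewrite psum_S. specialize (Ha n). lra.
- exists l. now apply is_series_psum.
Qed.

(* Tannery's theorem: the tail of the n-th sum is at most the tail of [M], and
   letting n tend to infinity gives |l - sum_{k<J} v k| <= sum_{k>=J} M k. *)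
Lemma tannery (u : nat -> nat -> R) (v M : nat -> R) (m : nat -> nat) (l : R) :
  (forall k, is_lim_seq (fun n => u n k) (v k)) ->
  (forall J, eventually (fun n => (J <= m n)%nat)) ->
  (forall n k, (k < m n)%nat -> Rabs (u n k) <= M k) ->
  ex_series M ->
  is_lim_seq (fun n => psum (u n) (m n)) l ->
  is_series v l.
Proof.
intros Hv Hm Hb [LM HM] Hl.
assert (HM' : is_lim_seq (psum M) LM) by now apply is_series_psum.
assert (M0 : forall k, 0 <= M k).
{ intros k. destruct (Hm (S k)) as [n Hn].
  eapply Rle_trans; [apply Rabs_pos|apply (Hb n k)]. apply (Hn n); lia. }
assert (MLe : forall n, psum M n <= LM).
{ intros n. apply (is_lim_seq_incr_compare _ LM HM').
  intros p. rewrite psum_S. specialize (M0 p); lra. }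
assert (Hd : forall J, Rabs (l - psum v J) <= LM - psum M J).
{ intros J.
  apply (is_lim_seq_le_loc (fun n => Rabs (psum (u n) (m n) - psum (u n) J))
    (fun _ => LM - psum M J) (Rabs (l - psum v J)) (LM - psum M J)).
  - apply filter_imp with (2 := Hm J). intros n Hn.
    replace (m n) with (J + (m n - J))%nat by lia. rewrite psum_add.
    replace (psum (u n) J + psum (fun j => u n (J + j)%nat) (m n - J) - psum (u n) J)
      with (psum (fun j => u n (J + j)%nat) (m n - J)) by ring.
    eapply Rle_trans; [apply psum_abs|].
    apply Rle_trans with (psum (fun j => M (J + j)%nat) (m n - J)).
    + apply psum_le. intros j Hj. apply Hb; lia.
    + assert (E := MLe (J + (m n - J))%nat). rewrite psum_add in E. lra.
  - apply (is_lim_seq_abs _ (Finite _)). apply is_lim_seq_minus'; auto.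
    induction J as [|J IH]; [apply is_lim_seq_const|].
    apply is_lim_seq_plus'; auto.
  - apply is_lim_seq_const. }
apply is_series_psum.
apply is_lim_seq_ext with (fun J => l - (l - psum v J)); [intros; ring|].
replace (Finite l) with (Finite (l - 0)) by (f_equal; ring).
apply is_lim_seq_minus'; [apply is_lim_seq_const|].
apply is_lim_seq_abs_0.
apply is_lim_seq_le_le with (fun _ => 0) (fun J => LM - psum M J).
- intros J; split; [apply Rabs_pos|auto].
- apply is_lim_seq_const.
- replace (Finite 0) with (Finite (LM - LM)) by (f_equal; ring).
  apply is_lim_seq_minus'; auto. apply is_lim_seq_const.
Qed.

(** * Partial sums of zeta, and zeta(2), zeta(4) from cosecant sums *)

Definition zetaN (s n : nat) : R := psum (fun k => / (INR k + 1) ^ s) n.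

Lemma ex_series_zeta s : (2 <= s)%nat -> ex_series (fun k => / (INR k + 1) ^ s).
Proof.
intros Hs. apply ex_series_psum_bounded with 2.
- intros k. assert (Hk := pos_INR k). left; apply Rinv_0_lt_compat, pow_lt; lra.
- intros n. eapply Rle_trans; [apply psum_le|apply (psum_inv_sq n)].
  intros j _. cbv beta. assert (Hj := pos_INR j).
  apply Rinv_le_contravar; [apply pow_lt; lra|]. apply Rle_pow; lra || auto.
Qed.

Lemma psum_rev f n : psum f n = psum (fun k => f (n - 1 - k)%nat) n.
Proof.
induction n as [|n IH]; auto.
rewrite (psum_S_l (fun k => f (S n - 1 - k)%nat)), psum_S, IH, Rplus_comm.
f_equal; [f_equal; lia|]. apply psum_ext. intros j Hj. f_equal; lia.
Qed.

Lemma psum_fold f m : psum f (2 * m) = psum (fun k => f k + f (2 * m - 1 - k)%nat) m.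
Proof.
replace (2 * m)%nat with (m + m)%nat at 1 by lia.
rewrite psum_add, psum_plus. f_equal. rewrite psum_rev. apply psum_ext.
intros j Hj. f_equal; lia.
Qed.

(** For k < 2^n these are the odd multiples of pi/2^(n+2) in (0, pi/2). The grid of level n + 1
    consists of the halves of the grid of level n and their reflections in pi/4, which gives a
    recurrence for sums over it. *)
Definition angle (n k : nat) : R := (2 * INR k + 1) * PI / 2 ^ (n + 2).

Lemma angle_bounds n k : (k < 2 ^ n)%nat -> 0 < angle n k < PI / 2.
Proof.
intros Hk. unfold angle. assert (HP := PI_RGT_0). assert (H2 := pow_lt 2 n ltac:(lra)).
assert (Hk0 := pos_INR k).
apply (le_INR (S k)) in Hk. rewrite S_INR, pow_INR in Hk. change (INR 2) with 2 in Hk.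
rewrite pow_add. split.
- apply Rdiv_lt_0_compat; nra.
- apply Rmult_lt_reg_r with (2 ^ n * 2 ^ 2); [nra|].
  replace ((2 * INR k + 1) * PI / (2 ^ n * 2 ^ 2) * (2 ^ n * 2 ^ 2)) with
    (PI * (2 * INR k + 1)) by (field; lra).
  replace (PI / 2 * (2 ^ n * 2 ^ 2)) with (PI * (2 * 2 ^ n)) by field.
  apply Rmult_lt_compat_l; lra.
Qed.

Lemma angle_succ n k : angle n k = 2 * angle (S n) k.
Proof.
unfold angle. rewrite !pow_add. simpl. field. apply pow_nonzero; lra.
Qed.

Lemma angle_reflect n k : (k < 2 ^ n)%nat ->
  angle (S n) (2 * 2 ^ n - 1 - k) = PI / 2 - angle (S n) k.
Proof.
intros Hk. unfold angle. rewrite !minus_INR, mult_INR, pow_INR by lia.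
change (INR 2) with 2. change (INR 1) with 1. rewrite pow_add. simpl. field. apply pow_nonzero; lra.
Qed.

Definition cscN (s n : nat) : R := psum (fun k => / sin (angle n k) ^ s) (2 ^ n).

Lemma cscN_succ s n :
  cscN s (S n) = psum (fun k => / sin (angle (S n) k) ^ s + / cos (angle (S n) k) ^ s) (2 ^ n).
Proof.
unfold cscN. rewrite Nat.pow_succ_r', psum_fold. apply psum_ext. intros k Hk.
now rewrite angle_reflect, sin_shift by auto.
Qed.

Lemma csc_half_angle n k : (k < 2 ^ n)%nat ->
  sin (angle n k) = 2 * sin (angle (S n) k) * cos (angle (S n) k) /\
  sin (angle (S n) k) <> 0 /\ cos (angle (S n) k) <> 0.
Proof.
intros Hk. assert (B := angle_bounds n k Hk). rewrite angle_succ in B.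
rewrite angle_succ, sin_2a. split; auto. split; apply Rgt_not_eq.
- apply sin_gt_0; lra.
- apply cos_gt_0; lra.
Qed.

Lemma sin2_cos2' x : sin x ^ 2 = 1 - cos x ^ 2.
Proof. assert (H := sin2_cos2 x). unfold Rsqr in H. lra. Qed.

(** By 1/sin^2 t + 1/cos^2 t = 4 / sin^2 (2t), each level multiplies the sum by 4, starting from
    1/sin^2 (pi/4) = 2. *)
Lemma cscN_2 n : cscN 2 n = 2 * 4 ^ n.
Proof.
induction n as [|n IH].
- unfold cscN, angle; simpl. replace ((2 * 0 + 1) * PI / (2 * (2 * 1))) with (PI / 4) by field.
  rewrite sin_PI4. assert (Hs := sqrt_lt_R0 2 ltac:(lra)).
  replace (1 / sqrt 2 * (1 / sqrt 2 * 1)) with (/ (sqrt 2 * sqrt 2)) by (field; lra).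
  rewrite sqrt_sqrt; lra.
- rewrite cscN_succ.
  rewrite (psum_ext _ (fun k => 4 * / sin (angle n k) ^ 2)).
  + rewrite psum_scal. fold (cscN 2 n). rewrite IH. simpl; ring.
  + intros k Hk. destruct (csc_half_angle n k Hk) as [E [Hs Hc]]. rewrite E.
    replace (/ sin (angle (S n) k) ^ 2 + / cos (angle (S n) k) ^ 2) with
      ((sin (angle (S n) k) ^ 2 + cos (angle (S n) k) ^ 2) /
        (sin (angle (S n) k) ^ 2 * cos (angle (S n) k) ^ 2)) by (field; auto).
    rewrite sin2_cos2' at 1. field; auto.
Qed.

(** With a = sin t and b = cos t, 1/a^4 + 1/b^4 = (1 - 2 a^2 b^2)/(a b)^4 = 16 / sin^4 (2t) - 8 /
    sin^2 (2t). The closed form solves the resulting recurrence, given [cscN_2]. *)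
Lemma cscN_4 n : cscN 4 n = 16 ^ n * (8 / 3 + 4 / 3 * / 4 ^ n).
Proof.
induction n as [|n IH].
- unfold cscN, angle; simpl. replace ((2 * 0 + 1) * PI / (2 * (2 * 1))) with (PI / 4) by field.
  rewrite sin_PI4. assert (Hs := sqrt_lt_R0 2 ltac:(lra)).
  replace (1 / sqrt 2 * (1 / sqrt 2 * (1 / sqrt 2 * (1 / sqrt 2 * 1)))) with
    (/ (sqrt 2 * sqrt 2) * / (sqrt 2 * sqrt 2)) by (field; lra).
  rewrite sqrt_sqrt; lra.
- rewrite cscN_succ.
  rewrite (psum_ext _ (fun k => 16 * / sin (angle n k) ^ 4 + (-8) * / sin (angle n k) ^ 2)).
  + rewrite psum_plus, !psum_scal. fold (cscN 2 n) (cscN 4 n). rewrite IH, cscN_2.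
    replace 16 with (4 * 4) by ring. rewrite !Rpow_mult_distr. simpl.
    field. apply pow_nonzero; lra.
  + intros k Hk. destruct (csc_half_angle n k Hk) as [E [Hs Hc]]. rewrite E.
    assert (P := sin2_cos2' (angle (S n) k)).
    set (a := sin (angle (S n) k)) in *. set (b := cos (angle (S n) k)) in *.
    replace (/ a ^ 4 + / b ^ 4) with
      (((a ^ 2 + b ^ 2) ^ 2 - 2 * a ^ 2 * b ^ 2) * / (a ^ 4 * b ^ 4)) by (field; auto).
    replace (a ^ 2 + b ^ 2) with 1 by lra.
    field; auto.
Qed.

(** x - x^3/6 = x (1 - x^2/6) is a lower bound, and x^2 <= 4. *)
Lemma sin_lower x : 0 <= x <= 2 -> x / 3 <= sin x.
Proof.
intros Hx. destruct (pre_sin_bound x 0 ltac:(lra) ltac:(lra)) as [H _].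
unfold sin_approx, sin_term in H; simpl in H. nra.
Qed.

Lemma scaled_sin_lim c : c <> 0 -> is_lim_seq (fun n => 2 ^ n * sin (c / 2 ^ n)) c.
Proof.
intros Hc.
assert (P : forall n, 0 < 2 ^ n) by (intros; apply pow_lt; lra).
apply is_lim_seq_ext with (fun n => c * (sin (c / 2 ^ n) / (c / 2 ^ n))).
{ intros n. assert (Q := P n). field. split; auto; lra. }
replace (Finite c) with (Rbar_mult c 1) by (simpl; f_equal; ring).
apply is_lim_seq_scal_l.
apply (is_lim_comp_seq (fun x => sin x / x) (fun n => c / 2 ^ n) 0 1 is_lim_sinc_0).
- exists O. intros n _ E. injection E as E.
  assert (Q := P n). apply Rmult_integral in E. destruct E as [E|E]; auto.
  apply Rinv_neq_0_compat in E; auto; lra.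
- apply is_lim_seq_ext with (fun n => c * (/ 2) ^ n).
  + intros n. rewrite pow_inv. reflexivity.
  + replace (Finite 0) with (Rbar_mult c 0) by (simpl; f_equal; ring).
    apply is_lim_seq_scal_l, is_lim_seq_geom. rewrite Rabs_pos_eq; lra.
Qed.

(** Tannery's theorem for the rescaled cosecants: 2^n sin ([angle n k]) tends to (2k + 1) pi/4. *)
Lemma is_series_csc s (l : R) : (2 <= s)%nat ->
  is_lim_seq (fun n => cscN s n / (2 ^ n) ^ s) l ->
  is_series (fun k => / ((2 * INR k + 1) * PI / 4) ^ s) l.
Proof.
intros Hs Hl. assert (HP := PI_RGT_0).
assert (P : forall n, 0 < 2 ^ n) by (intros; apply pow_lt; lra).
apply tannery with (u := fun n k => / (2 ^ n * sin (angle n k)) ^ s) (m := fun n => (2 ^ n)%nat)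
  (M := fun k => 4 ^ s * / (INR k + 1) ^ s).
- intros k. assert (Hk := pos_INR k).
  assert (Hc : 0 < (2 * INR k + 1) * PI / 4) by (apply Rdiv_lt_0_compat; nra).
  assert (L := scaled_sin_lim _ (Rgt_not_eq _ _ Hc)).
  apply is_lim_seq_ext with
    (fun n => (fun y => / y ^ s) (2 ^ n * sin ((2 * INR k + 1) * PI / 4 / 2 ^ n))).
  { intros n. cbv beta. do 4 f_equal. unfold angle. rewrite pow_add.
    assert (Q := P n). field; lra. }
  apply is_lim_seq_continuous with (f := fun y => / y ^ s); auto.
  apply continuity_pt_inv; [|apply pow_nonzero; lra].
  apply derivable_continuous_pt, derivable_pt_pow.
- intros J. exists J. intros n Hn. assert (H := Nat.pow_gt_lin_r 2 n ltac:(lia)). lia.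
- intros n k Hk. assert (Hk0 := pos_INR k). assert (Q := P n).
  assert (B := angle_bounds n k Hk). assert (P4 := PI_4).
  assert (Hsin := sin_lower (angle n k) ltac:(lra)).
  assert (HP3 := PI2_3_2).
  (* [sin_lower] gives (2k + 1) pi/12, and pi > 3. *)
  assert (H : (INR k + 1) / 4 <= 2 ^ n * sin (angle n k)).
  { apply Rle_trans with (2 ^ n * (angle n k / 3)); [|apply Rmult_le_compat_l; lra].
    unfold angle. rewrite pow_add.
    replace (2 ^ n * ((2 * INR k + 1) * PI / (2 ^ n * 2 ^ 2) / 3)) with
      ((2 * INR k + 1) * PI / 12) by (field; lra). nra. }
  assert (Hpos : 0 < (INR k + 1) / 4) by lra.
  rewrite Rabs_pos_eq by (left; apply Rinv_0_lt_compat, pow_lt; lra).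
  replace (4 ^ s * / (INR k + 1) ^ s) with (/ ((INR k + 1) / 4) ^ s).
  + apply Rinv_le_contravar; [now apply pow_lt|]. apply pow_incr; lra.
  + unfold Rdiv. rewrite Rpow_mult_distr, pow_inv. field.
    split; apply pow_nonzero; lra.
- apply (ex_series_scal (V := R_NormedModule) (4 ^ s) (fun k => / (INR k + 1) ^ s)). now apply ex_series_zeta.
- apply is_lim_seq_ext with (2 := Hl). intros n. unfold cscN, Rdiv.
  rewrite Rmult_comm, <- psum_scal. apply psum_ext. intros k _.
  rewrite Rpow_mult_distr, Rinv_mult. reflexivity.
Qed.

Lemma zetaN_double s n :
  zetaN s (2 * n) = psum (fun k => / (2 * INR k + 1) ^ s) n + / 2 ^ s * zetaN s n.
Proof.
unfold zetaN. induction n as [|n IH]; [simpl; ring|].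
replace (2 * S n)%nat with (S (S (2 * n))) by lia.
rewrite !psum_S, IH, S_INR, mult_INR. change (INR 2) with 2.
replace (2 * INR n + 1 + 1) with (2 * (INR n + 1)) by ring.
rewrite Rpow_mult_distr, Rinv_mult. ring.
Qed.

(** The cosecant limit yields the sum over odd integers. In the limit [zetaN_double] reads z = odd
    part + z/2^s, which is solved for z. *)
Lemma zetaN_lim_of_csc s (l : R) : (2 <= s)%nat ->
  is_lim_seq (fun n => cscN s n / (2 ^ n) ^ s) l ->
  is_lim_seq (zetaN s) (l * (PI / 4) ^ s / (1 - / 2 ^ s)).
Proof.
intros Hs Hl. assert (HP := PI_RGT_0).
assert (H2 : / 2 ^ s < 1).
{ rewrite <- Rinv_1. apply Rinv_lt_contravar.
  - rewrite Rmult_1_l; apply pow_lt; lra.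
  - apply Rlt_pow_R1; [lra|lia]. }
assert (O : is_lim_seq (psum (fun k => / (2 * INR k + 1) ^ s)) (l * (PI / 4) ^ s)).
{ assert (H := is_series_csc s l Hs Hl). apply is_series_psum in H.
  apply is_lim_seq_ext with
    (fun n => psum (fun k => / ((2 * INR k + 1) * PI / 4) ^ s) n * (PI / 4) ^ s).
  - intros n. rewrite Rmult_comm, <- psum_scal. apply psum_ext. intros k _.
    assert (Hk := pos_INR k). unfold Rdiv. rewrite Rmult_assoc, !Rpow_mult_distr.
    field. repeat split; apply pow_nonzero; lra.
  - apply (is_lim_seq_scal_r _ _ (Finite l)); auto. }
destruct (ex_series_zeta s Hs) as [z Hz]. apply is_series_psum in Hz.
fold (zetaN s) in Hz. change (is_lim_seq (zetaN s) z) in Hz.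
assert (E : z = l * (PI / 4) ^ s + / 2 ^ s * z).
{ assert (L1 : is_lim_seq (fun n => zetaN s (2 * n)) z).
  { apply (is_lim_seq_subseq _ _ (fun n => (2 * n)%nat)); auto.
    apply eventually_subseq. intros; lia. }
  assert (L2 : is_lim_seq (fun n => zetaN s (2 * n)) (l * (PI / 4) ^ s + / 2 ^ s * z)).
  { apply is_lim_seq_ext with (1 := fun n => eq_sym (zetaN_double s n)).
    apply is_lim_seq_plus'; auto. apply (is_lim_seq_scal_l _ _ (Finite z)); auto. }
  apply is_lim_seq_unique in L1. apply is_lim_seq_unique in L2. congruence. }
replace (l * (PI / 4) ^ s / (1 - / 2 ^ s)) with z; auto.
apply Rmult_eq_reg_r with (1 - / 2 ^ s); [|lra].
unfold Rdiv at 1. rewrite Rmult_assoc, Rinv_l by lra. lra.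
Qed.

Lemma zetaN_2_lim : is_lim_seq (zetaN 2) (PI ^ 2 / 6).
Proof.
replace (PI ^ 2 / 6) with (2 * (PI / 4) ^ 2 / (1 - / 2 ^ 2)) by field.
apply zetaN_lim_of_csc; auto.
apply is_lim_seq_ext with (2 := is_lim_seq_const 2).
intros n. rewrite cscN_2, <- pow_mult, Nat.mul_comm, pow_mult.
replace (2 ^ 2) with 4 by ring. field. apply pow_nonzero; lra.
Qed.

Lemma zetaN_4_lim : is_lim_seq (zetaN 4) (PI ^ 4 / 90).
Proof.
replace (PI ^ 4 / 90) with ((8 / 3 + 4 / 3 * 0) * (PI / 4) ^ 4 / (1 - / 2 ^ 4)) by field.
apply zetaN_lim_of_csc; [lia|].
apply is_lim_seq_ext with (fun n => 8 / 3 + 4 / 3 * (/ 4) ^ n).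
- intros n. rewrite cscN_4, <- pow_mult, Nat.mul_comm, pow_mult.
  replace (2 ^ 4) with 16 by ring. rewrite pow_inv. field. split; apply pow_nonzero; lra.
- apply is_lim_seq_plus'; [apply is_lim_seq_const|].
  apply (is_lim_seq_scal_l _ _ (Finite 0)), is_lim_seq_geom. rewrite Rabs_pos_eq; lra.
Qed.

Lemma zetaN_3_lim : is_lim_seq (zetaN 3) (zeta 3).
Proof.
apply (is_series_psum _ (zeta 3)).
unfold zeta. rewrite (Series_ext _ (fun k => / (INR k + 1) ^ 3)).
- apply Series_correct, ex_series_zeta; lia.
- intros n. f_equal. replace 3 with (INR 3) by (simpl; ring).
  rewrite Rpower_pow by (apply lt_0_INR; lia). now rewrite S_INR.
Qed.

(** * Power sums of the roots *)

(** Polynomial functions of degree at most [d], in Horner form; the coefficients stay existential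
    because only the number of roots matters. *)
Fixpoint polyn (d : nat) (f : R -> R) : Prop :=
  match d with
  | O => exists c, forall x, f x = c
  | S d' => exists c g, polyn d' g /\ forall x, f x = c + x * g x
  end.

Lemma polyn_ext d f g : (forall x, f x = g x) -> polyn d f -> polyn d g.
Proof.
intros E. destruct d as [|d]; simpl.
- intros [c H]. exists c. intros x. now rewrite <- E.
- intros [c [h [Hh H]]]. exists c, h. split; auto. intros x. now rewrite <- E.
Qed.

Lemma polyn_up d f : polyn d f -> polyn (S d) f.
Proof.
revert f; induction d as [|d IH]; intros f.
- intros [c H]. exists c, (fun _ => 0). split; [now exists 0|].
  intros x. rewrite H; ring.
- intros [c [g [Hg H]]]. exists c, g. split; auto.
Qed.

Lemma polyn_plus d f g : polyn d f -> polyn d g -> polyn d (fun x => f x + g x).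
Proof.
revert f g; induction d as [|d IH]; intros f g.
- intros [a Ha] [b Hb]. exists (a + b). intros x. now rewrite Ha, Hb.
- intros [a [f' [Hf Ha]]] [b [g' [Hg Hb]]].
  exists (a + b), (fun x => f' x + g' x). split; auto.
  intros x. rewrite Ha, Hb; ring.
Qed.

Lemma polyn_scal d c f : polyn d f -> polyn d (fun x => c * f x).
Proof.
revert f; induction d as [|d IH]; intros f.
- intros [a Ha]. exists (c * a). intros x. now rewrite Ha.
- intros [a [f' [Hf Ha]]]. exists (c * a), (fun x => c * f' x). split; auto.
  intros x. rewrite Ha; ring.
Qed.

Lemma polyn_mulX d f : polyn d f -> polyn (S d) (fun x => x * f x).
Proof. intros H. exists 0, f. split; auto. intros; ring. Qed.

Lemma polyn_mul_linear d u v f : polyn d f -> polyn (S d) (fun x => (u + v * x) * f x).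
Proof.
intros H.
apply polyn_ext with (fun x => u * f x + x * (v * f x)); [intros; ring|].
apply polyn_plus; [apply polyn_up|apply polyn_mulX]; now apply polyn_scal.
Qed.

(** Synthetic division: if f x = c + x g x and g x - g a = (x - a) h x, then f x - f a = (x - a)(g x
    + a h x). *)
Lemma polyn_factor d f a : polyn (S d) f ->
  exists g, polyn d g /\ forall x, f x = f a + (x - a) * g x.
Proof.
revert f; induction d as [|d IH]; intros f [c [g [Hg H]]].
- exists g. split; auto. destruct Hg as [b Hb].
  intros x. rewrite !H, !Hb; ring.
- destruct (IH g Hg) as [h [Hh E]].
  exists (fun x => g x + a * h x). split.
  + apply polyn_plus; auto. apply polyn_up. now apply polyn_scal.
  + intros x. rewrite !H. replace (g x) with (g a + (x - a) * h x) by now rewrite (E x).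
    ring.
Qed.

Lemma polyn_roots n f (a : nat -> R) : polyn n f ->
  (forall j k, (j < k < n)%nat -> a j <> a k) ->
  (forall k, (k < n)%nat -> f (a k) = 0) ->
  exists c, forall x, f x = c * pprod (fun k => x - a k) n.
Proof.
revert f; induction n as [|n IH]; intros f Hf Ha Hr.
- destruct Hf as [c Hc]. exists c. intros x. simpl. rewrite Hc; ring.
- destruct (polyn_factor n f (a n) Hf) as [g [Hg E]].
  destruct (IH g Hg) as [c Hc].
  + intros j k Hjk. apply Ha; lia.
  + intros k Hk. assert (Hk0 := Hr k ltac:(lia)).
    rewrite E, Hr in Hk0 by lia. rewrite Rplus_0_l in Hk0.
    apply Rmult_integral in Hk0. destruct Hk0 as [H|H]; auto.
    exfalso. apply (Ha k n); [lia|lra].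
  + exists c. intros x. simpl. rewrite E, Hc, Hr by lia. ring.
Qed.

(** * Expansions to order four at 0 *)

Definition bdd (r : R -> R) := exists M, forall z, Rabs z <= / 2 -> Rabs (r z) <= M.

Lemma bdd_const c : bdd (fun _ => c).
Proof. exists (Rabs c). intros; lra. Qed.

Lemma bdd_id : bdd (fun z => z).
Proof. exists (/ 2). auto. Qed.

Lemma bdd_plus r s : bdd r -> bdd s -> bdd (fun z => r z + s z).
Proof.
intros [M HM] [N HN]. exists (M + N). intros z Hz.
eapply Rle_trans; [apply Rabs_triang|]. apply Rplus_le_compat; auto.
Qed.

Lemma bdd_mult r s : bdd r -> bdd s -> bdd (fun z => r z * s z).
Proof.
intros [M HM] [N HN]. exists (M * N). intros z Hz. rewrite Rabs_mult.
apply Rmult_le_compat; auto using Rabs_pos.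
Qed.

Lemma bdd_pow r n : bdd r -> bdd (fun z => r z ^ n).
Proof.
intros H. induction n as [|n IH]; simpl; [apply bdd_const|now apply bdd_mult].
Qed.

Ltac solve_bdd :=
  repeat first [assumption | apply bdd_const | apply bdd_id | apply bdd_plus
               | apply bdd_mult | apply bdd_pow].

(** Asking for a bounded remainder instead of derivatives makes products a matter of ring
    arithmetic. The radius 1/2 keeps z away from the poles -1, -2, ... of the factor treated in
    [jet_psi_factor]. *)
Definition jet (f : R -> R) (c1 c2 c3 c4 : R) : Prop :=
  exists r, bdd r /\ forall z, Rabs z <= / 2 ->
    f z = 1 + c1 * z + c2 * z ^ 2 + c3 * z ^ 3 + c4 * z ^ 4 + z ^ 5 * r z.

(* For [1 + c1 z + c2 z^2 + ... = prod (1 - z / a)], Newton's identities turn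
   [p4] into the sum of the [1 / a^4]. *)
Definition p4 (c1 c2 c3 c4 : R) : R :=
  c1 ^ 4 - 4 * c1 ^ 2 * c2 + 2 * c2 ^ 2 + 4 * c1 * c3 - 4 * c4.

Lemma jet_mult f g c1 c2 c3 c4 d1 d2 d3 d4 : jet f c1 c2 c3 c4 -> jet g d1 d2 d3 d4 ->
  jet (fun z => f z * g z) (c1 + d1) (c2 + c1 * d1 + d2) (c3 + c2 * d1 + c1 * d2 + d3)
    (c4 + c3 * d1 + c2 * d2 + c1 * d3 + d4).
Proof.
intros [r [Hr Hf]] [s [Hs Hg]].
exists (fun z =>
  r z * (1 + d1 * z + d2 * z ^ 2 + d3 * z ^ 3 + d4 * z ^ 4) +
  (1 + c1 * z + c2 * z ^ 2 + c3 * z ^ 3 + c4 * z ^ 4) * s z + z ^ 5 * r z * s z +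
  ((c1 * d4 + c2 * d3 + c3 * d2 + c4 * d1) + (c2 * d4 + c3 * d3 + c4 * d2) * z +
   (c3 * d4 + c4 * d3) * z ^ 2 + c4 * d4 * z ^ 3)).
split; [solve_bdd|].
intros z Hz. rewrite Hf, Hg by auto. ring.
Qed.

(** [p4] is -4 times the z^4 coefficient of the logarithm of the series, so it turns products into
    sums. *)
Lemma p4_mult c1 c2 c3 c4 d1 d2 d3 d4 :
  p4 (c1 + d1) (c2 + c1 * d1 + d2) (c3 + c2 * d1 + c1 * d2 + d3)
    (c4 + c3 * d1 + c2 * d2 + c1 * d3 + d4) = p4 c1 c2 c3 c4 + p4 d1 d2 d3 d4.
Proof. unfold p4; ring. Qed.

Lemma bdd_vanish a g : bdd g -> (forall z, z <> 0 -> Rabs z <= / 2 -> a + z * g z = 0) -> a = 0.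
Proof.
intros [M HM] H. destruct (Req_dec a 0) as [E|E]; auto. exfalso.
assert (Ha := Rabs_pos_lt _ E).
assert (M0 : 0 <= M).
{ eapply Rle_trans; [apply Rabs_pos|apply (HM 0)]. rewrite Rabs_R0; lra. }
(* With this z, |z g z| is at most |a|/2, contradicting |a| = |z g z|. *)
assert (Hz : 0 < Rmin (/ 2) (Rabs a / (2 * (M + 1)))).
{ apply Rmin_glb_lt; [lra|]. apply Rdiv_lt_0_compat; lra. }
set (z := Rmin (/ 2) (Rabs a / (2 * (M + 1)))) in *.
assert (Z1 : z <= / 2) by apply Rmin_l.
assert (Z2 : z <= Rabs a / (2 * (M + 1))) by apply Rmin_r.
assert (Hz2 : Rabs z <= / 2) by (rewrite Rabs_pos_eq; lra).
specialize (H z ltac:(lra) Hz2). specialize (HM z Hz2).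
assert (Ea : Rabs a = z * Rabs (g z)).
{ replace a with (- (z * g z)) by lra. rewrite Rabs_Ropp, Rabs_mult, (Rabs_pos_eq z); lra. }
assert (B : z * (M + 1) <= Rabs a / 2).
{ apply Rle_trans with (Rabs a / (2 * (M + 1)) * (M + 1)).
  - apply Rmult_le_compat_r; lra.
  - right; field; lra. }
nra.
Qed.

(** Coefficients are compared one at a time: divide the difference by z and let z tend to 0. *)
Lemma jet_unique f c1 c2 c3 c4 d1 d2 d3 d4 : jet f c1 c2 c3 c4 -> jet f d1 d2 d3 d4 ->
  p4 c1 c2 c3 c4 = p4 d1 d2 d3 d4.
Proof.
intros [r [Hr Hf]] [s [Hs Hg]].
assert (E : forall z, Rabs z <= / 2 -> z * ((c1 - d1) + z * ((c2 - d2) + z * ((c3 - d3) +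
  z * ((c4 - d4) + z * (r z + (-1) * s z))))) = 0).
{ intros z Hz. assert (H := Hf z Hz). rewrite (Hg z Hz) in H.
  apply Rminus_diag_eq in H. rewrite <- (Ropp_0), <- H. ring. }
assert (E1 : c1 - d1 = 0).
{ apply bdd_vanish with (fun z => (c2 - d2) + z * ((c3 - d3) +
    z * ((c4 - d4) + z * (r z + (-1) * s z)))); [solve_bdd|].
  intros z Hz0 Hz. apply Rmult_eq_reg_l with z; auto. rewrite Rmult_0_r. auto. }
assert (E2 : c2 - d2 = 0).
{ apply bdd_vanish with (fun z => (c3 - d3) +
    z * ((c4 - d4) + z * (r z + (-1) * s z))); [solve_bdd|].
  intros z Hz0 Hz. apply Rmult_eq_reg_l with z; auto. apply Rmult_eq_reg_l with z; auto.
  rewrite !Rmult_0_r. rewrite <- (E z Hz), E1. ring. }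
assert (E3 : c3 - d3 = 0).
{ apply bdd_vanish with (fun z => (c4 - d4) + z * (r z + (-1) * s z)); [solve_bdd|].
  intros z Hz0 Hz. do 3 (apply Rmult_eq_reg_l with z; auto).
  rewrite !Rmult_0_r. rewrite <- (E z Hz), E1, E2. ring. }
assert (E4 : c4 - d4 = 0).
{ apply bdd_vanish with (fun z => r z + (-1) * s z); [solve_bdd|].
  intros z Hz0 Hz. do 4 (apply Rmult_eq_reg_l with z; auto).
  rewrite !Rmult_0_r. rewrite <- (E z Hz), E1, E2, E3. ring. }
replace d1 with c1 by lra. replace d2 with c2 by lra.
replace d3 with c3 by lra. replace d4 with c4 by lra. reflexivity.
Qed.

(** The elementary symmetric functions never have to be written out: [p4] is additive, and a factor
    1 - z/a contributes [p4 (-1/a) 0 0 0], that is 1/a^4. *)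
Lemma jet_pprod (a : nat -> R) n :
  exists c1 c2 c3 c4, jet (fun z => pprod (fun k => 1 - z / a k) n) c1 c2 c3 c4 /\
    p4 c1 c2 c3 c4 = psum (fun k => / a k ^ 4) n.
Proof.
induction n as [|n [c1 [c2 [c3 [c4 [J P]]]]]].
- exists 0, 0, 0, 0. split; [|simpl; unfold p4; ring].
  exists (fun _ => 0). split; [solve_bdd|]. intros; simpl; ring.
- do 4 eexists. split.
  + simpl. apply jet_mult with (1 := J). instantiate (1 := 0). instantiate (1 := 0).
    instantiate (1 := 0). instantiate (1 := - / a n).
    exists (fun _ => 0). split; [solve_bdd|]. intros z _; unfold Rdiv; ring.
  + rewrite p4_mult, P, psum_S. f_equal. rewrite <- pow_inv. unfold p4; ring.
Qed.

(** * The numerator of [psiN] and the fourth power sum of its roots *)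

Definition psi_den (m : nat) (z : R) : R := pprod (fun j => 1 + z / (INR j + 1)) m.

(* The polynomial [psi_den m z * (1 - L z + z * sum_(1 <= j <= m) 1 / (z + j))], which
   is [-z] times [L - sum_(0 <= j <= m) 1 / (z + j)] up to the factor [psi_den m z]. *)
Fixpoint psi_num (L : R) (m : nat) (z : R) : R :=
  match m with
  | O => 1 - z * L
  | S m' => (1 + z / (INR m' + 1)) * psi_num L m' z + z / (INR m' + 1) * psi_den m' z
  end.

Lemma psi_den_polyn m : polyn m (psi_den m).
Proof.
induction m as [|m IH]; [now exists 1|].
apply polyn_ext with (2 := polyn_mul_linear _ 1 (/ (INR m + 1)) _ IH).
intros x. unfold psi_den. simpl. unfold Rdiv. ring.
Qed.

Lemma psi_num_polyn L m : polyn (S m) (psi_num L m).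
Proof.
induction m as [|m IH].
- exists 1, (fun _ => - L). split; [now exists (- L)|]. intros; simpl; ring.
- apply polyn_ext with (fun x => (1 + / (INR m + 1) * x) * psi_num L m x +
    x * (/ (INR m + 1) * psi_den m x)).
  + intros x. simpl. unfold Rdiv. ring.
  + apply polyn_plus; [now apply polyn_mul_linear|].
    apply polyn_up, polyn_mulX, polyn_scal, psi_den_polyn.
Qed.

Lemma psi_num_0 L m : psi_num L m 0 = 1.
Proof. induction m as [|m IH]; simpl; [ring|]. rewrite IH. unfold Rdiv; ring. Qed.

Lemma psi_num_eq L m z : (forall j, (j < m)%nat -> z + (INR j + 1) <> 0) ->
  psi_num L m z = psi_den m z * (1 - z * L + z * psum (fun j => / (z + (INR j + 1))) m).
Proof.
induction m as [|m IH]; intros H; [simpl; unfold psi_den; simpl; ring|].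
simpl psi_num. rewrite IH by auto. unfold psi_den. simpl pprod. rewrite psum_S.
assert (Hm := pos_INR m). assert (H0 := H m ltac:(lia)).
field. split; auto; lra.
Qed.

(** A finite geometric expansion of 1/(z + a) with a = j + 1, up to z^4 / (a^4 (z + a)). Each
    remainder is at most 2, since a >= 1 and z + a >= 1/2. *)
Lemma jet_psi_factor L m :
  jet (fun z => 1 - z * L + z * psum (fun j => / (z + (INR j + 1))) m)
    (zetaN 1 m - L) (- zetaN 2 m) (zetaN 3 m) (- zetaN 4 m).
Proof.
exists (fun z => psum (fun j => / ((INR j + 1) ^ 4 * (z + (INR j + 1)))) m).
split.
- induction m as [|m [M HM]]; [simpl; solve_bdd|].
  exists (M + 2). intros z Hz. rewrite psum_S.
  eapply Rle_trans; [apply Rabs_triang|]. apply Rplus_le_compat; auto.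
  assert (Hm := pos_INR m). assert (Hz' := Hz). apply Rabs_le_between in Hz'.
  assert (H1 : 1 <= (INR m + 1) ^ 4) by (apply pow_R1_Rle; lra).
  rewrite Rabs_inv, Rabs_pos_eq by nra.
  replace 2 with (/ / 2) by field. apply Rinv_le_contravar; nra.
- intros z Hz. apply Rabs_le_between in Hz.
  induction m as [|m IH]; [unfold zetaN; simpl; ring|].
  unfold zetaN in *. rewrite !psum_S.
  assert (Hm := pos_INR m).
  replace (/ (z + (INR m + 1))) with
    (/ (INR m + 1) ^ 1 - z * / (INR m + 1) ^ 2 + z ^ 2 * / (INR m + 1) ^ 3
     - z ^ 3 * / (INR m + 1) ^ 4 + z ^ 4 * / ((INR m + 1) ^ 4 * (z + (INR m + 1))))
    by (field; split; lra).
  rewrite Rmult_plus_distr_l, <- Rplus_assoc, IH. ring.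
Qed.

(** [p4] of [psi_num] is computed twice: from its roots, and as [psi_den] times the factor of
    [jet_psi_factor]. The factor contributes 4 [zetaN 4 m] and [psi_den] one more, whence the 5. *)
Lemma power_sum_4 L m (a : nat -> R) :
  (forall j k, (j < k <= m)%nat -> a j <> a k) ->
  (forall k, (k <= m)%nat -> nonpole (a k)) ->
  (forall k, (k <= m)%nat -> L - psum (fun j => / (a k + INR j)) (S m) = 0) ->
  psum (fun k => / a k ^ 4) (S m) =
    (zetaN 1 m - L) ^ 4 + 4 * (zetaN 1 m - L) ^ 2 * zetaN 2 m + 2 * zetaN 2 m ^ 2
    + 4 * (zetaN 1 m - L) * zetaN 3 m + 5 * zetaN 4 m.
Proof.
intros Hinj Hnp Hroot.
assert (Ha0 : forall k, (k <= m)%nat -> a k <> 0).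
{ intros k Hk E. apply (Hnp k Hk 0%nat). simpl. lra. }
destruct (polyn_roots (S m) (psi_num L m) a) as [c Hc].
- apply psi_num_polyn.
- intros j k Hjk. apply Hinj; lia.
- intros k Hk. assert (Hr := Hroot k ltac:(lia)). rewrite psum_S_l in Hr.
  assert (Hk0 := Ha0 k ltac:(lia)).
  rewrite psi_num_eq.
  + rewrite (psum_ext _ (fun j => / (a k + INR (S j)))) by (intros; now rewrite S_INR).
    change (INR 0) with 0 in Hr. rewrite Rplus_0_r in Hr.
    replace (psum _ m) with (L - / a k) by lra.
    field_simplify; auto.
  + intros j Hj. rewrite <- S_INR. apply Hnp; lia.
(* The unknown leading constant is fixed by the value 1 at 0. *)
- assert (E : forall z, psi_num L m z = pprod (fun k => 1 - z / a k) (S m)).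
  { assert (H0 := Hc 0). rewrite psi_num_0 in H0.
    intros z. rewrite Hc.
    rewrite (pprod_ext (fun k => z - a k) (fun k => (0 - a k) * (1 - z / a k))).
    - rewrite pprod_mult, <- Rmult_assoc, <- H0. ring.
    - intros k Hk. field. apply Ha0; lia. }
  destruct (jet_pprod a (S m)) as [c1 [c2 [c3 [c4 [J P]]]]].
  (* [psi_den] is the product of 1 - z/a over a = -1, ..., -m. *)
  destruct (jet_pprod (fun j => - (INR j + 1)) m) as [d1 [d2 [d3 [d4 [J' P']]]]].
  assert (J2 := jet_mult _ _ _ _ _ _ _ _ _ _ J' (jet_psi_factor L m)).
  rewrite <- P.
  match type of J2 with jet _ ?e1 ?e2 ?e3 ?e4 =>
    replace (p4 c1 c2 c3 c4) with (p4 e1 e2 e3 e4) end.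
  + rewrite p4_mult, P'. unfold p4.
    rewrite (psum_ext _ (fun k => / (INR k + 1) ^ 4)).
    * fold (zetaN 4 m). ring.
    * intros j _. f_equal. ring.
  + symmetry. apply jet_unique with (1 := J).
    destruct J2 as [r [Hr HJ]]. exists r; split; auto.
    intros z Hz. rewrite <- HJ, <- E by auto.
    rewrite psi_num_eq.
    * f_equal. apply pprod_ext. intros j _. assert (Hj := pos_INR j). field; lra.
    * intros j _. assert (Hj := pos_INR j). apply Rabs_le_between in Hz. lra.
Qed.

(** * Location of the zeros *)

Lemma zetaN_succ s n : zetaN s (S n) = zetaN s n + / INR (S n) ^ s.
Proof. unfold zetaN. now rewrite psum_S, S_INR. Qed.

(** The lower bound 1/n, rather than 0, is what carries the induction: one step loses at most 1/n -
    1/(n + 1). *)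
Lemma zetaN_1_ln n : (1 <= n)%nat -> / INR n <= zetaN 1 n - ln (INR n) <= 1.
Proof.
intros Hn. induction Hn as [|n Hn IH].
- unfold zetaN; simpl. rewrite ln_1. split; right; field.
- assert (B := ln_succ_bounds n Hn). rewrite zetaN_succ, pow_1. lra.
Qed.

Lemma zetaN_term_le_1 m n : (m <= n)%nat -> 0 <= zetaN 1 n - zetaN 1 m <= INR (n - m).
Proof.
intros H. unfold zetaN. replace n with (m + (n - m))%nat at 1 2 by lia.
rewrite psum_add, Rplus_minus_l.
assert (T : forall j, 0 < / (INR (m + j) + 1) ^ 1 <= 1).
{ intros j. assert (Hj := pos_INR (m + j)). rewrite pow_1. split.
  - apply Rinv_0_lt_compat; lra.
  - rewrite <- Rinv_1. apply Rinv_le_contravar; lra. }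
split.
- rewrite <- (Rmult_0_r (INR (n - m))), <- psum_const. apply psum_le.
  intros j _. left. apply T.
- rewrite <- (Rmult_1_r (INR (n - m))), <- psum_const. apply psum_le. intros j _. apply T.
Qed.

Lemma euler_constant_lim :
  is_lim_seq (fun n => zetaN 1 n - ln (INR n)) euler_constant.
Proof.
assert (E : forall n, sum_n_m (fun k => / INR k) 1 n - ln (INR n) = zetaN 1 n - ln (INR n)).
{ intros n. f_equal. induction n as [|n IH].
  - rewrite sum_n_m_zero by lia. reflexivity.
  - rewrite sum_n_Sm by lia. rewrite IH, zetaN_succ, pow_1. reflexivity. }
unfold euler_constant.
rewrite (Lim_seq_ext _ _ E).
apply Lim_seq_correct'.
apply ex_lim_seq_quadratic with 1 1%nat; auto.
intros n Hn. rewrite zetaN_succ, pow_1. assert (B := ln_succ_bounds n Hn).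
apply Rabs_le_between. lra.
Qed.

(* The interval between consecutive poles that contains the k-th zero. *)
Definition cell (k : nat) (x : R) : Prop :=
  (forall j, (j < k)%nat -> x + INR j < 0) /\ (forall j, (k <= j)%nat -> 0 < x + INR j).

Lemma cell_nonpole k x : cell k x -> nonpole x.
Proof.
intros [H1 H2] j. destruct (Nat.lt_ge_cases j k) as [H|H].
- apply Rlt_not_eq; auto.
- apply Rgt_not_eq, Rlt_gt; auto.
Qed.

Lemma nonpole_cell x : nonpole x -> exists k, cell k x.
Proof.
intros Hx. destruct (INR_unbounded (- x)) as [n Hn].
assert (Hn' : 0 < x + INR n) by lra. clear Hn. induction n as [|n IH].
- exists O. split; [intros; lia|]. intros j _. simpl in Hn'. assert (Hj := pos_INR j). lra.
- destruct (Rlt_or_le 0 (x + INR n)) as [H|H]; auto.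
  assert (H' : x + INR n < 0) by (assert (E := Hx n); lra).
  exists (S n). split; intros j Hj; apply le_INR in Hj; rewrite ?S_INR in *; lra.
Qed.

Lemma psum_ge_term f n k : (forall j, 0 <= f j) -> (k < n)%nat -> f k <= psum f n.
Proof.
intros Hf Hk. apply Rle_trans with (psum f (S k)); [|apply psum_mono; auto].
rewrite psum_S, <- (Rplus_0_l (f k)) at 1. apply Rplus_le_compat_r.
apply (psum_mono f 0 k); auto; lia.
Qed.

(** The difference is the sum of (y - x)/((x + j)(y + j)), whose terms are nonnegative because x and
    y lie on the same side of every pole. Keeping the term j = k leaves a bound free of [N], so
    strictness survives in the limit. *)
Lemma psiN_increase k N x y : cell k x -> cell k y -> x <= y -> (k <= N)%nat ->
  (y - x) / ((x + INR k) * (y + INR k)) <= psiN N y - psiN N x.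
Proof.
intros Hx Hy Hxy HN.
assert (Nx := cell_nonpole _ _ Hx). assert (Ny := cell_nonpole _ _ Hy).
destruct Hx as [Hx1 Hx2]. destruct Hy as [Hy1 Hy2].
replace (psiN N y - psiN N x) with
  (psum (fun j => (y - x) / ((x + INR j) * (y + INR j))) (S N)).
- apply psum_ge_term with (f := fun j => (y - x) / ((x + INR j) * (y + INR j))); [|lia].
  intros j. apply Rmult_le_pos; [lra|]. left. apply Rinv_0_lt_compat.
  destruct (Nat.lt_ge_cases j k) as [H|H].
  + specialize (Hx1 j H). specialize (Hy1 j H). nra.
  + specialize (Hx2 j H). specialize (Hy2 j H). nra.
- rewrite (psum_ext _ (fun j => / (x + INR j) + (-1) * / (y + INR j))).
  + rewrite psum_plus, psum_scal. unfold psiN. ring.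
  + intros j _. field. split; auto.
Qed.

Lemma psi_increase k x y : cell k x -> cell k y -> x < y -> psi x < psi y.
Proof.
intros Hx Hy Hxy.
assert (Px := proj2 Hx k (le_n k)). assert (Py := proj2 Hy k (le_n k)).
assert (D : 0 < (y - x) / ((x + INR k) * (y + INR k))).
{ apply Rdiv_lt_0_compat; [lra|nra]. }
assert (H : (y - x) / ((x + INR k) * (y + INR k)) <= psi y - psi x); [|lra].
apply (is_lim_seq_le_loc (fun _ => (y - x) / ((x + INR k) * (y + INR k)))
  (fun n => psiN n y - psiN n x) (Finite _) (Finite _)).
- exists k. intros n Hn. apply psiN_increase; auto; lra.
- apply is_lim_seq_const.
- apply is_lim_seq_minus'; apply psiN_lim.
Qed.

(** Ends of a bracket inside the k-th cell. For k = m + 1 the cell is (-(m + 1), -m), and the margin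
    1/(2m + 6) is small enough for the pole nearby to outweigh the bound 2m + 2 of
    [psiN_near_poles]. *)
Definition lo (k : nat) : R :=
  match k with O => / 2 | S m => - (INR m + 1) + / (2 * INR m + 6) end.

Definition hi (k : nat) : R :=
  match k with O => 5 | S m => - INR m - / (2 * INR m + 6) end.

Lemma margin_bounds m : 0 < / (2 * INR m + 6) <= / 6.
Proof.
assert (Hm := pos_INR m). split.
- apply Rinv_0_lt_compat; lra.
- apply Rinv_le_contravar; lra.
Qed.

Lemma lo_lt_hi k : lo k < hi k.
Proof.
destruct k as [|m]; simpl; [lra|]. assert (B := margin_bounds m). lra.
Qed.

Lemma hi_lt_lo j k : (j < k)%nat -> hi k < lo j.
Proof.
intros H. induction H as [|k H IH].
- destruct j as [|m]; unfold hi, lo.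
  + simpl. lra.
  + assert (B := margin_bounds m). assert (B' := margin_bounds (S m)).
    rewrite S_INR in *. lra.
- apply Rlt_trans with (hi k); auto. eapply Rlt_trans; [|apply lo_lt_hi].
  destruct k as [|m]; unfold hi, lo; [simpl; lra|].
  assert (B := margin_bounds m). assert (B' := margin_bounds (S m)).
  rewrite S_INR in *. lra.
Qed.

Lemma bracket_cell k x : lo k <= x <= hi k -> cell k x.
Proof.
intros H. destruct k as [|m]; unfold lo, hi in H.
- split; [intros; lia|]. intros j _. assert (Hj := pos_INR j). lra.
- assert (B := margin_bounds m). split; intros j Hj.
  + apply le_S_n, le_INR in Hj. lra.
  + apply le_INR in Hj. rewrite S_INR in Hj. lra.
Qed.

(** The poles j = m and j = m + 1 give 1/(1 - t) and -1/t. The terms j < m sum to between -m and 0,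
    and the remaining [N - S m] terms lie within 1 of a harmonic number, itself within m + 1 of
    [zetaN 1 N], which [zetaN_1_ln] compares with ln N. *)
Lemma psiN_near_poles m N t : (S m <= N)%nat -> 0 < t < 1 ->
  -1 - / t + / (1 - t) <= psiN N (- (INR m + 1) + t) <= 2 * INR m + 2 - / t + / (1 - t).
Proof.
intros HN Ht. unfold psiN.
replace (S N) with (m + S (S (N - S m)))%nat by lia.
set (r := (N - S m)%nat).
rewrite psum_add, !psum_S_l.
assert (Hm := pos_INR m).
replace (- (INR m + 1) + t + INR (m + 0)) with (- (1 - t)) by (rewrite Nat.add_0_r; ring).
replace (- (INR m + 1) + t + INR (m + 1)) with t by (rewrite plus_INR; simpl; ring).
rewrite Rinv_opp.
assert (A : - INR m <= psum (fun j => / (- (INR m + 1) + t + INR j)) m <= 0).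
{ assert (T : forall j, (j < m)%nat -> -1 <= / (- (INR m + 1) + t + INR j) <= 0).
  { intros j Hj. apply le_INR in Hj. rewrite S_INR in Hj.
    replace (- (INR m + 1) + t + INR j) with (- (INR m + 1 - t - INR j)) by ring.
    rewrite Rinv_opp.
    assert (0 < / (INR m + 1 - t - INR j)) by (apply Rinv_0_lt_compat; lra).
    assert (/ (INR m + 1 - t - INR j) <= / 1) by (apply Rinv_le_contravar; lra).
    rewrite Rinv_1 in *. lra. }
  split.
  - replace (- INR m) with (INR m * (-1)) by ring. rewrite <- psum_const.
    apply psum_le. intros j Hj; apply (T j Hj).
  - rewrite <- (Rmult_0_r (INR m)), <- psum_const.
    apply psum_le. intros j Hj; apply (T j Hj). }
assert (TT : zetaN 1 r - 1 <=
  psum (fun j => / (- (INR m + 1) + t + INR (m + S (S j)))) r <= zetaN 1 r).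
{ split.
  - assert (E : zetaN 1 (S r) = 1 + psum (fun j => / (INR j + 1 + 1)) r).
    { unfold zetaN. rewrite psum_S_l. f_equal; [simpl; field|].
      apply psum_ext. intros j _. now rewrite S_INR, pow_1. }
    assert (E2 := zetaN_term_le_1 r (S r) ltac:(lia)).
    apply Rle_trans with (psum (fun j => / (INR j + 1 + 1)) r); [lra|].
    apply psum_le. intros j _. assert (Hj := pos_INR j).
    rewrite plus_INR, !S_INR. apply Rinv_le_contravar; lra.
  - unfold zetaN. apply psum_le. intros j _. assert (Hj := pos_INR j).
    rewrite plus_INR, !S_INR, pow_1. apply Rinv_le_contravar; lra. }
assert (L := zetaN_1_ln N ltac:(lia)).
assert (0 < / INR N) by (apply Rinv_0_lt_compat, lt_0_INR; lia).
assert (D := zetaN_term_le_1 r N ltac:(lia)).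
replace (N - r)%nat with (S m) in D by lia. rewrite S_INR in D.
lra.
Qed.

(** The terms dominate those of the harmonic sum, and the first exceeds its counterpart by 1. *)
Lemma psiN_half N : (1 <= N)%nat -> psiN N (/ 2) <= -1.
Proof.
intros HN. unfold psiN.
assert (L := zetaN_1_ln N HN).
assert (0 < / INR N) by (apply Rinv_0_lt_compat, lt_0_INR; lia).
assert (D := zetaN_term_le_1 N (S N) ltac:(lia)).
assert (H1 : zetaN 1 (S N) + 1 <= psum (fun j => / (/ 2 + INR j)) (S N)).
{ unfold zetaN. rewrite !psum_S_l.
  assert (psum (fun j => / (INR (S j) + 1) ^ 1) N <= psum (fun j => / (/ 2 + INR (S j))) N).
  { apply psum_le. intros j _. assert (Hj := pos_INR j).
    rewrite S_INR, pow_1. apply Rinv_le_contravar; lra. }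
  simpl (INR 0). lra. }
lra.
Qed.

(** 25/12 = 1 + 1/2 + 1/3 + 1/4. The five terms beyond N are at most 1/9 each once N >= 8, and 25/12
    - 1 - 5/9 = 19/36 just exceeds 1/2. *)
Lemma psiN_five N : (8 <= N)%nat -> / 2 <= psiN N 5.
Proof.
intros HN. unfold psiN.
assert (L := zetaN_1_ln N ltac:(lia)).
assert (E : psum (fun j => / (5 + INR j)) (S N) = zetaN 1 (4 + S N) - 25 / 12).
{ unfold zetaN. rewrite psum_add.
  rewrite (psum_ext (fun j => / (INR (4 + j) + 1) ^ 1) (fun j => / (5 + INR j))).
  - simpl. field. assert (Hn := pos_INR N). lra.
  - intros j _. rewrite plus_INR, pow_1. f_equal. simpl. ring. }
rewrite E. change (4 + S N)%nat with (S (S (S (S (S N))))). rewrite !zetaN_succ, !pow_1, !S_INR.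
apply le_INR in HN. simpl (INR 8) in HN.
assert (I : forall y, 9 <= y -> / y <= / 9) by (intros; apply Rinv_le_contravar; lra).
assert (I1 := I (INR N + 1)). assert (I2 := I (INR N + 1 + 1)).
assert (I3 := I (INR N + 1 + 1 + 1)). assert (I4 := I (INR N + 1 + 1 + 1 + 1)).
assert (I5 := I (INR N + 1 + 1 + 1 + 1 + 1)). lra.
Qed.

Lemma psiN_bracket k N : (8 <= N)%nat -> (k <= N)%nat ->
  psiN N (lo k) <= - / 2 /\ / 2 <= psiN N (hi k).
Proof.
intros H8 Hk. destruct k as [|m].
- split; [apply Rle_trans with (-1); [apply psiN_half; lia|lra]|now apply psiN_five].
- assert (B := margin_bounds m). assert (Hm := pos_INR m). unfold lo, hi.
  (* At [lo] the bound is 2m + 2 - (2m + 6) + 6/5; at [hi], with 1 - t for t, it is -1 - 6/5 + 2m +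
     6. *)
  set (t := / (2 * INR m + 6)) in *.
  assert (Et : / t = 2 * INR m + 6) by (unfold t; now rewrite Rinv_inv).
  assert (T1 : 1 <= / (1 - t) <= 6 / 5).
  { split.
    - rewrite <- Rinv_1 at 1. apply Rinv_le_contravar; lra.
    - replace (6 / 5) with (/ (5 / 6)) by field. apply Rinv_le_contravar; lra. }
  split.
  + assert (H := psiN_near_poles m N t Hk ltac:(lra)). lra.
  + replace (- INR m - t) with (- (INR m + 1) + (1 - t)) by ring.
    assert (H := psiN_near_poles m N (1 - t) Hk ltac:(lra)).
    replace (1 - (1 - t)) with t in H by ring. lra.
Qed.

Lemma psi_bracket k : psi (lo k) <= - / 2 /\ / 2 <= psi (hi k).
Proof.
split.
- apply (is_lim_seq_le_loc (fun n => psiN n (lo k)) (fun _ => - / 2) (psi (lo k)) (- / 2)).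
  + exists (8 + k)%nat. intros n Hn. apply psiN_bracket; lia.
  + apply psiN_lim.
  + apply is_lim_seq_const.
- apply (is_lim_seq_le_loc (fun _ => / 2) (fun n => psiN n (hi k)) (/ 2) (psi (hi k))).
  + exists (8 + k)%nat. intros n Hn. apply psiN_bracket; lia.
  + apply is_lim_seq_const.
  + apply psiN_lim.
Qed.

(** * The roots of [psiN] and [psi], and their convergence *)

Lemma psiN_root N k :
  {r | (8 <= N)%nat -> (k <= N)%nat -> lo k <= r <= hi k /\ psiN N r = 0}.
Proof.
(* Out of range the root defaults to 0, which keeps [rootN] total. *)
destruct (Compare_dec.le_dec 8 N) as [H8|H8]; [|exists 0; lia].
destruct (Compare_dec.le_dec k N) as [Hk|Hk]; [|exists 0; lia].
destruct (IVT_interv (psiN N) (lo k) (hi k)) as [r Hr].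
- intros x Hx. apply psiN_continuity, cell_nonpole with k, bracket_cell; auto.
- apply lo_lt_hi.
- assert (B := psiN_bracket k N H8 Hk). lra.
- assert (B := psiN_bracket k N H8 Hk). lra.
- exists r; auto.
Qed.

Definition rootN (N k : nat) : R := proj1_sig (psiN_root N k).

Lemma rootN_spec N k : (8 <= N)%nat -> (k <= N)%nat ->
  lo k <= rootN N k <= hi k /\ psiN N (rootN N k) = 0.
Proof. apply (proj2_sig (psiN_root N k)). Qed.

Lemma psi_root k : {r | lo k <= r <= hi k /\ psi r = 0}.
Proof.
assert (B := psi_bracket k).
apply IVT_interv.
- intros x Hx. apply psi_continuity, cell_nonpole with k, bracket_cell; auto.
- apply lo_lt_hi.
- lra.
- lra.
Qed.

Definition root (k : nat) : R := proj1_sig (psi_root k).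

Lemma root_spec k : lo k <= root k <= hi k /\ psi (root k) = 0.
Proof. apply (proj2_sig (psi_root k)). Qed.

(** Every real non-pole lies in some cell, and [psi] is strictly increasing on each cell. *)
Lemma psi_zero_root x : nonpole x -> psi x = 0 -> exists k, x = root k.
Proof.
intros Hx H0. destruct (nonpole_cell x Hx) as [k Hk]. exists k.
destruct (root_spec k) as [Hr Hr0]. apply bracket_cell in Hr.
destruct (Rtotal_order x (root k)) as [H|[H|H]]; auto; exfalso.
- apply (psi_increase k) in H; auto; lra.
- apply (psi_increase k) in H; auto; lra.
Qed.

Lemma bracket_size k x : lo k <= x <= hi k -> 0 < x + INR k <= 5.
Proof.
intros H. destruct k as [|m].
- simpl in *. lra.
- unfold lo, hi in H. rewrite S_INR. assert (B := margin_bounds m). lra.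
Qed.

(** On a bracket x + k and y + k are at most 5, so [psiN_increase] gives slope at least 1/25. *)
Lemma psiN_expansive k N x y : lo k <= x <= hi k -> lo k <= y <= hi k -> (k <= N)%nat ->
  Rabs (y - x) <= 25 * Rabs (psiN N y - psiN N x).
Proof.
assert (W : forall x y, lo k <= x <= hi k -> lo k <= y <= hi k -> (k <= N)%nat -> x <= y ->
  Rabs (y - x) <= 25 * Rabs (psiN N y - psiN N x)).
{ intros x' y' Hx Hy HN Hxy.
  assert (I := psiN_increase k N x' y' (bracket_cell _ _ Hx) (bracket_cell _ _ Hy) Hxy HN).
  assert (Bx := bracket_size _ _ Hx). assert (By := bracket_size _ _ Hy).
  assert (J : (y' - x') * / 25 <= psiN N y' - psiN N x').
  { eapply Rle_trans; [|apply I]. apply Rmult_le_compat_l; [lra|].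
    apply Rinv_le_contravar; nra. }
  rewrite !Rabs_pos_eq; lra. }
intros Hx Hy HN. destruct (Rle_or_lt x y) as [H|H]; auto.
rewrite (Rabs_minus_sym y), (Rabs_minus_sym (psiN N y)). apply W; auto; lra.
Qed.

(** The distance of the two roots is at most 25 |[psiN n (root k)]|, which tends to 25
    |[psi (root k)]| = 0. *)
Lemma rootN_lim k : is_lim_seq (fun n => rootN (n + 8) k) (root k).
Proof.
destruct (root_spec k) as [Hr Hr0].
apply (is_lim_seq_incr_n (fun n => rootN n k)).
apply is_lim_seq_ext with (fun n => root k - (root k - rootN n k)); [intros; ring|].
replace (Finite (root k)) with (Finite (root k - 0)) by (f_equal; ring).
apply is_lim_seq_minus'; [apply is_lim_seq_const|].
apply is_lim_seq_abs_0.
apply is_lim_seq_le_le_loc with (fun _ => 0) (fun n => 25 * Rabs (psiN n (root k))).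
- exists (8 + k)%nat. intros n Hn. split; [apply Rabs_pos|].
  destruct (rootN_spec n k ltac:(lia) ltac:(lia)) as [Hs Hs0].
  replace (psiN n (root k)) with (psiN n (root k) - psiN n (rootN n k)) by (rewrite Hs0; ring).
  apply psiN_expansive with k; auto; lia.
- apply is_lim_seq_const.
- replace (Finite 0) with (Rbar_mult 25 (Rabs 0)) by (simpl; rewrite Rabs_R0; f_equal; ring).
  apply is_lim_seq_scal_l. apply (is_lim_seq_abs _ (Finite 0)).
  rewrite <- Hr0. apply psiN_lim.
Qed.

(** The constant is dictated by k = 1, where the bracket ends at -1/6 = -2/12. *)
Lemma bracket_abs_lower k x : lo k <= x <= hi k -> (INR k + 1) / 12 <= Rabs x.
Proof.
intros H. destruct k as [|m]; unfold lo, hi in H.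
- simpl. rewrite Rabs_pos_eq; lra.
- assert (Hm := pos_INR m). rewrite S_INR.
  assert (B := margin_bounds m). rewrite Rabs_left by lra.
  destruct m as [|m]; [simpl in *; lra|].
  rewrite S_INR in *. assert (Hm' := pos_INR m). lra.
Qed.

Lemma is_series_root :
  is_series (fun k => / root k ^ 4)
    (euler_constant ^ 4 + 2 * euler_constant ^ 2 * PI ^ 2 / 3 + PI ^ 4 / 9
     + 4 * euler_constant * zeta 3).
Proof.
apply tannery with (u := fun n k => / rootN (n + 8) k ^ 4) (m := fun n => S (n + 8))
  (M := fun k => 12 ^ 4 * / (INR k + 1) ^ 4).
- intros k. assert (Hne : root k <> 0).
  { destruct (root_spec k) as [Hr _]. apply bracket_cell, cell_nonpole in Hr.
    intros E. apply (Hr 0%nat). simpl. lra. }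
  apply is_lim_seq_continuous with (f := fun y => / y ^ 4); [|apply rootN_lim].
  apply continuity_pt_inv; [|now apply pow_nonzero].
  apply derivable_continuous_pt, derivable_pt_pow.
- intros J. exists J. intros n Hn. lia.
- intros n k Hk. destruct (rootN_spec (n + 8) k ltac:(lia) ltac:(lia)) as [Hr _].
  apply bracket_abs_lower in Hr. assert (Hk0 := pos_INR k).
  rewrite Rabs_inv, <- RPow_abs.
  replace (12 ^ 4 * / (INR k + 1) ^ 4) with (/ ((INR k + 1) / 12) ^ 4) by (field; lra).
  apply Rinv_le_contravar; [apply pow_lt; lra|]. apply pow_incr; lra.
- apply (ex_series_scal (V := R_NormedModule) (12 ^ 4) (fun k => / (INR k + 1) ^ 4)).
  apply ex_series_zeta; lia.
- pose (S4 n := (zetaN 1 n - ln (INR n)) ^ 4 + 4 * (zetaN 1 n - ln (INR n)) ^ 2 * zetaN 2 n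
    + 2 * zetaN 2 n ^ 2 + 4 * (zetaN 1 n - ln (INR n)) * zetaN 3 n + 5 * zetaN 4 n).
  apply is_lim_seq_ext with (fun n => S4 (n + 8)%nat).
  + intros n. unfold S4. symmetry. apply power_sum_4.
    * intros j k Hjk. apply Rgt_not_eq.
      destruct (rootN_spec (n + 8) j ltac:(lia) ltac:(lia)) as [Hj _].
      destruct (rootN_spec (n + 8) k ltac:(lia) ltac:(lia)) as [Hk _].
      assert (H := hi_lt_lo j k ltac:(lia)). lra.
    * intros k Hk. apply cell_nonpole with k, bracket_cell, rootN_spec; lia.
    * intros k Hk. apply (rootN_spec (n + 8) k); lia.
  + apply (is_lim_seq_incr_n S4).
    (* 2 (pi^2/6)^2 and 5 pi^4/90 are both pi^4/18. *)
    replace (euler_constant ^ 4 + 2 * euler_constant ^ 2 * PI ^ 2 / 3 + PI ^ 4 / 9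
      + 4 * euler_constant * zeta 3) with
      (euler_constant ^ 4 + 4 * euler_constant ^ 2 * (PI ^ 2 / 6) + 2 * (PI ^ 2 / 6) ^ 2
       + 4 * euler_constant * zeta 3 + 5 * (PI ^ 4 / 90)) by field.
    assert (Lpow : forall (u : nat -> R) (l : R) p,
      is_lim_seq u l -> is_lim_seq (fun n => u n ^ p) (l ^ p)).
    { intros u l p Hu. apply is_lim_seq_continuous with (f := fun y => y ^ p); auto.
      apply derivable_continuous_pt, derivable_pt_pow. }
    unfold S4. repeat first
      [ apply is_lim_seq_plus' | apply is_lim_seq_mult' | apply is_lim_seq_const
      | apply Lpow | apply zetaN_2_lim | apply zetaN_3_lim | apply zetaN_4_lim
      | apply euler_constant_lim ].
Qed.

(** * Matching the given sequence with the roots *)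

Lemma decr_lt (a : nat -> R) : (forall k, a (S k) < a k) ->
  forall j k, (j < k)%nat -> a k < a j.
Proof.
intros Ha j k H. induction H as [|k H IH]; auto. apply Rlt_trans with (a k); auto.
Qed.

(** By induction a k = b j for some j >= k. Used in both directions, it shows that strictly
    decreasing sequences with the same range agree term by term. *)
Lemma decr_range_le (a b : nat -> R) :
  (forall k, a (S k) < a k) -> (forall k, b (S k) < b k) ->
  (forall k, exists j, a k = b j) -> forall k, a k <= b k.
Proof.
intros Ha Hb Hab k.
assert (H : exists j, (k <= j)%nat /\ a k = b j).
{ induction k as [|k [j [Hj E]]].
  - destruct (Hab 0%nat) as [j Hj]. exists j; split; auto; lia.
  - destruct (Hab (S k)) as [i Hi]. exists i. split; auto.
    destruct (Nat.lt_ge_cases j i) as [H|H]; [lia|]. exfalso.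
    assert (Hk := Ha k). rewrite Hi, E in Hk.
    destruct (Nat.eq_dec i j) as [->|Hne]; [lra|].
    assert (H' := decr_lt b Hb i j ltac:(lia)). lra. }
destruct H as [j [Hj E]]. rewrite E.
destruct (Nat.eq_dec k j) as [->|Hne]; [lra|].
left. apply decr_lt; auto; lia.
Qed.

Theorem mainTheorem5 (alpha : nat -> R)
  (alpha_decr : forall k : nat, alpha (S k) < alpha k)
  (alpha_zeros : forall z : C,
     digamma_zero z <-> exists k : nat, z = RtoC (alpha k)) :
  is_series (fun k : nat => 1 / alpha k ^ 4)
    (euler_constant ^ 4 + 2 * euler_constant ^ 2 * PI ^ 2 / 3 + PI ^ 4 / 9
     + 4 * euler_constant * zeta 3).
Proof.
assert (root_decr : forall k, root (S k) < root k).
{ intros k. assert (H := root_spec k). assert (H' := root_spec (S k)).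
  assert (L := hi_lt_lo k (S k) ltac:(lia)). lra. }
assert (E : forall k, alpha k = root k).
{ intros k. apply Rle_antisym.
  - apply decr_range_le; auto. intros j. apply psi_zero_root.
    + apply (digamma_zero_RtoC (alpha j)), alpha_zeros. now exists j.
    + apply (digamma_zero_RtoC (alpha j)), alpha_zeros. now exists j.
  - apply decr_range_le; auto. intros j.
    destruct (proj1 (alpha_zeros (RtoC (root j)))) as [i Hi].
    + apply digamma_zero_RtoC. destruct (root_spec j) as [Hr Hr0]. split; auto.
      now apply cell_nonpole with j, bracket_cell.
    + exists i. now apply RtoC_inj. }
apply is_series_ext with (2 := is_series_root).
intros k. rewrite E. unfold Rdiv. now rewrite Rmult_1_l.
Qed.
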